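(* Let $\mathcal{A}$ be a family of surfaces in $\mathbb{R}^3$ satisfying the Hopf maximum principle, and let $\Sigma\in\mathcal{A}$ be a compact graph on a domain $\Omega$ in the $xy$-plane (i.e. $\Sigma=\{(x,y,u(x,y)) : (x,y)\in\Omega\}$) with $\partial\Sigma$ contained in this plane. Then for all $p\in\Sigma$, the distance in $\mathbb{R}^3$ from $p$ to the $xy$-plane is less than or equal to $4R_{\mathcal{A}}$, where $R_{\mathcal{A}}$ is the radius of the unique totally umbilical sphere in the family $\mathcal{A}$.
   Context: Surfaces are connected and differentiable ($C^\infty$), possibly with boundary. A family $\mathcal{A}$ of oriented surfaces in $\mathbb{R}^3$ satisfies the Hopf maximum principle if: (1) $\mathcal{A}$ is invariant under isometries of $\mathbb{R}^3$: if $\Sigma\in\mathcal{A}$ and $\varphi$ is an isometry of $\mathbb{R}^3$ then $\varphi(\Sigma)\in\mathcal{A}$; (2) if $\Sigma\in\mathcal{A}$ and $\widetilde\Sigma$ is another surface contained in $\Sigma$, then $\widetilde\Sigma\in\mathcal{A}$; (3) there is an embedded compact surface without boundary in $\mathcal{A}$; (4) any two surfaces in $\mathcal{A}$ satisfy the (interior and boundary) maximum principle: if $\Sigma_1,\Sigma_2\in\mathcal{A}$ are tangent at a point $p$ which is interior to both (or is a boundary point of both at which $\partial\Sigma_1$ and $\partial\Sigma_2$ are also tangent, both surfaces being locally graphs over the same side), their unit normals coincide at $p$, and near $p$ one of the surfaces lies on one side of the other, then $\Sigma_1$ and $\Sigma_2$ coincide in a neighborhood of $p$. For such a family there is, up to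 isometries of $\mathbb{R}^3$, a unique embedded compact surface without boundary in $\mathcal{A}$, and it is a totally umbilical (round) sphere; $R_{\mathcal{A}}$ denotes its radius. *)

(* Defs.v *)
(* MathComp-Analysis; R : realType is the field of real numbers. *)
From mathcomp Require Import all_boot all_order all_algebra.
From mathcomp Require Import all_classical all_reals all_analysis.

Set Implicit Arguments.
Unset Strict Implicit.
Unset Printing Implicit Defensive.

Import Order.TTheory GRing.Theory Num.Theory.
Import numFieldNormedType.Exports.

Local Open Scope classical_set_scope.
Local Open Scope ring_scope.

(* The library norm on row vectors is the sup norm: it provides the (usual)
   topology and derivatives, whereas lengths and distances are taken for the
   Euclidean norm [enorm]. *)
Definition dot (R : realType) (n : nat) (v w : 'rV[R]_n) : R :=
  \sum_(i < n) v 0 i * w 0 i.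

Definition enorm (R : realType) (n : nat) (v : 'rV[R]_n) : R :=
  Num.sqrt (dot v v).

Definition isometry (R : realType) (phi : 'rV[R]_3 -> 'rV[R]_3) : Prop :=
  forall x y, enorm (phi x - phi y) = enorm (x - y).

Definition vec3 (R : realType) (a b c : R) : 'rV[R]_3 :=
  \row_(i < 3) [:: a; b; c]`_i.

Definition xy_plane (R : realType) : set 'rV[R]_3 := [set x | x 0 ord_max = 0].

Definition dist_to (R : realType) (A : set 'rV[R]_3) (x : 'rV[R]_3) : R :=
  inf [set enorm (x - y) | y in A].

Definition esphere (R : realType) (c : 'rV[R]_3) (r : R) : set 'rV[R]_3 :=
  [set x | enorm (x - c) = r].

Fixpoint Ck (R : realType) (k : nat) (U : set 'rV[R]_2)
    (F : 'rV[R]_2 -> 'rV[R]_3) : Prop :=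
  match k with
  | 0%N => forall w, U w -> {for w, continuous F}
  | k'.+1 => (forall w, U w -> differentiable F w) /\
             (forall v, Ck k' U ('D_v F))
  end.

Definition smooth_on (R : realType) (U : set 'rV[R]_2)
    (F : 'rV[R]_2 -> 'rV[R]_3) : Prop := forall k, Ck k U F.

Definition homeo_on (X Y : topologicalType) (A : set X) (B : set Y)
    (f : X -> Y) (g : Y -> X) : Prop :=
  [/\ {within A, continuous f} /\ {within B, continuous g},
      (forall x, A x -> B (f x)), (forall y, B y -> A (g y)),
      (forall x, A x -> g (f x) = x) & (forall y, B y -> f (g y) = y)].

Definition top_embedding (X Y : topologicalType) (f : X -> Y) : Prop :=
  exists g : Y -> X, homeo_on setT (range f) f g.

Definition halfplane (R : realType) : set 'rV[R]_2 := [set w | 0 <= w 0 1].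

(* [F] is a regular local parametrization of the map [psi : M -> R^3] around
   [p], over a neighbourhood of 0 in [D]: there is a homeomorphism [x] from
   [U `&` D] onto an open subset of M, with [x 0 = p], such that [psi \o x] is
   the restriction of the smooth map [F], whose differential is injective.
   [D] is the whole plane at an interior point, and the closed half-plane at a
   boundary point (smoothness up to the boundary being the existence of a
   smooth extension [F] to [U]). *)
Definition local_param (R : realType) (D : set 'rV[R]_2) (M : topologicalType)
    (psi : M -> 'rV[R]_3) (p : M) (F : 'rV[R]_2 -> 'rV[R]_3) : Prop :=
  exists (U : set 'rV[R]_2) (V : set M) (x : 'rV[R]_2 -> M) (y : M -> 'rV[R]_2),
    [/\ open_nbhs (0 : 'rV[R]_2) U /\ open V, x 0 = p, homeo_on (U `&` D) V x y,
        (forall w, (U `&` D) w -> psi (x w) = F w) &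
        smooth_on U F /\
        (forall w v, (U `&` D) w -> 'D_v F w = 0 -> v = 0)].

Definition interior_point (R : realType) (M : topologicalType)
    (psi : M -> 'rV[R]_3) (p : M) : Prop :=
  exists F, local_param setT psi p F.

Definition boundary_point (R : realType) (M : topologicalType)
    (psi : M -> 'rV[R]_3) (p : M) : Prop :=
  exists F, local_param (@halfplane R) psi p F.

Definition tangent_plane (R : realType) (M : topologicalType)
    (psi : M -> 'rV[R]_3) (p : M) : set 'rV[R]_3 :=
  [set v | exists F (w : 'rV[R]_2), (local_param setT psi p F \/
                        local_param (@halfplane R) psi p F) /\
                       v = 'D_w F 0].

(* Tangent line at the boundary point [p] to the boundary of the surface. *)
Definition boundary_tangent_line (R : realType) (M : topologicalType)
    (psi : M -> 'rV[R]_3) (p : M) : set 'rV[R]_3 :=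
  [set v | exists F (w : 'rV[R]_2), [/\ local_param (@halfplane R) psi p F,
                           w 0 1 = 0 & v = 'D_w F 0]].

(* Half of the tangent plane at the boundary point [p] consisting of the
   vectors that point towards the surface, boundary directions included. *)
Definition tangent_halfplane (R : realType) (M : topologicalType)
    (psi : M -> 'rV[R]_3) (p : M) : set 'rV[R]_3 :=
  [set v | exists F (w : 'rV[R]_2), [/\ local_param (@halfplane R) psi p F,
                           halfplane w & v = 'D_w F 0]].

(* Oriented connected immersed surfaces of R^3, possibly with boundary. The
   smooth structure of the carrier is the one for which [immersion] is a smooth
   immersion, and the orientation is given by a unit normal field (which is
   smooth as soon as it is continuous). *)
Record surface (R : realType) := Surface {
  carrier : topologicalType ;
  immersion : carrier -> 'rV[R]_3 ;
  normal : carrier -> 'rV[R]_3 ;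
  surface_hausdorff : hausdorff_space carrier ;
  surface_second_countable : @second_countable carrier ;
  surface_connected : connected [set: carrier] ;
  surface_nonempty : [set: carrier] !=set0 ;
  surface_locally : forall p,
    interior_point immersion p \/ boundary_point immersion p ;
  normal_continuous : continuous normal ;
  normal_unit : forall p, enorm (normal p) = 1 ;
  normal_orthogonal : forall p v,
    tangent_plane immersion p v -> dot v (normal p) = 0
}.

Definition embedded (R : realType) (S : surface R) : Prop :=
  top_embedding (@immersion R S).

Definition compact_surface (R : realType) (S : surface R) : Prop :=
  compact [set: carrier S].

Definition without_boundary (R : realType) (S : surface R) : Prop :=
  forall p : carrier S, ~ boundary_point (@immersion R S) p.

(* [S'] is [phi(S)], up to a homeomorphism [h] of the carriers; the unit normal
   is carried along by the differential of [phi]. *)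
Definition isometric_image (R : realType) (phi : 'rV[R]_3 -> 'rV[R]_3)
    (S S' : surface R) : Prop :=
  exists (h : carrier S' -> carrier S) (k : carrier S -> carrier S'),
    [/\ homeo_on setT setT h k,
        (forall q, immersion q = phi (immersion (h q))) &
        (forall q, normal q = 'D_(normal (h q)) phi (immersion (h q)))].

(* [S'] is contained in [S], with the induced orientation. *)
Definition subsurface (R : realType) (S' S : surface R) : Prop :=
  exists j : carrier S' -> carrier S,
    [/\ top_embedding j,
        (forall q, immersion q = immersion (j q)) &
        (forall q, normal q = normal (j q))].

Section Comparison.
Variables (R : realType) (S1 S2 : surface R).
Implicit Types (p : carrier S1) (q : carrier S2).

Definition tangent_at p q : Prop :=
  immersion p = immersion q /\
  tangent_plane (@immersion R S1) p = tangent_plane (@immersion R S2) q.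

Definition tangent_interior p q : Prop :=
  [/\ interior_point (@immersion R S1) p,
      interior_point (@immersion R S2) q & tangent_at p q].

(* Near [p] (resp. [q]) the surface is a graph over a one-sided neighbourhood
   of the origin in the common tangent plane, which lies on the side of
   [tangent_halfplane]. *)
Definition tangent_boundary p q : Prop :=
  [/\ boundary_point (@immersion R S1) p,
      boundary_point (@immersion R S2) q, tangent_at p q,
      boundary_tangent_line (@immersion R S1) p =
        boundary_tangent_line (@immersion R S2) q &
      tangent_halfplane (@immersion R S1) p =
        tangent_halfplane (@immersion R S2) q].

(* Both surfaces are viewed as graphs over their common tangent plane. The
   points [x] and [y] project to the same point of this plane when they differ
   by a multiple [t] of the normal, and [t] is the difference of the heights. *)
Definition heights_near p q (P : R -> Prop) : Prop :=
  \forall x \near p & y \near q,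
    forall t : R, immersion y = immersion x + t *: normal p -> P t.

Definition one_side p q : Prop :=
  heights_near p q (fun t => 0 <= t) \/ heights_near p q (fun t => t <= 0).

Definition coincide_near p q : Prop :=
  exists (V1 : set (carrier S1)) (V2 : set (carrier S2)),
    [/\ nbhs p V1, nbhs q V2 &
        (@immersion R S1) @` V1 = (@immersion R S2) @` V2].

(* At a boundary point the graphs may be defined over different one-sided
   neighbourhoods, with tangent boundaries (as for two discs of a sphere which
   are internally tangent); they can only be asked to coincide over the common
   part of these neighbourhoods. *)
Definition coincide_near_boundary p q : Prop :=
  heights_near p q (fun t => t = 0).

Definition maximum_principle : Prop :=
  forall p q, normal p = normal q -> one_side p q ->
    (tangent_interior p q -> coincide_near p q) /\
    (tangent_boundary p q -> coincide_near_boundary p q).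

End Comparison.

Definition hopf_family (R : realType) (A : surface R -> Prop) : Prop :=
  [/\ (forall (S S' : surface R) (phi : 'rV[R]_3 -> 'rV[R]_3), A S ->
         isometry phi -> isometric_image phi S S' -> A S'),
      (forall S S' : surface R, A S -> subsurface S' S -> A S'),
      (exists S : surface R,
         [/\ A S, embedded S, compact_surface S & without_boundary S]) &
      (forall S1 S2 : surface R, A S1 -> A S2 -> maximum_principle S1 S2)].

(* [r] is the radius of the (unique) totally umbilical sphere in the family. *)
Definition sphere_radius (R : realType) (A : surface R -> Prop) (r : R) :
    Prop :=
  0 < r /\
  exists (S : surface R) (c : 'rV[R]_3),
    [/\ A S, embedded S, compact_surface S, without_boundary S &
        range (@immersion R S) = esphere c r].

Definition closed_domain (R : realType) (Omega : set 'rV[R]_2) : Prop :=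
  exists D : set 'rV[R]_2,
    [/\ open D, connected D, D !=set0 & Omega = closure D].

Definition graph_on (R : realType) (S : surface R) (Omega : set 'rV[R]_2)
    (u : 'rV[R]_2 -> R) : Prop :=
  embedded S /\
  range (@immersion R S) = [set vec3 (w 0 0) (w 0 1) (u w) | w in Omega].

(* Main.v *)
(* Only the interior maximum principle is needed, at contacts inside the region
   under the graph.  Near such a contact the two surfaces coincide, so the set of
   contact points is open in S, which contradicts the choice of a contact point
   that is extremal in some direction.  The normals match at a contact because
   the sphere and S are co-oriented: otherwise the highest point of S could be
   touched from above by a sphere of radius R_A.

   Let t > 2 R_A.  If a component of {u > t} contained a path of x-width more than
   2 R_A, a ball of radius R_A between the heights 0 and t, and between the ends of
   the path, could be moved in the y-direction from behind the path to in front of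
   it.  The ball passes through the vertical wall below the path, which is inside
   the region under the graph, and before it leaves this region the part of it in
   front of the wall touches S from inside.  So each component has x-width at most
   2 R_A.  Alexandrov reflection in the planes z = x + s, applied over a component,
   bounds the height of S above the level t by this width.  For t close to 2 R_A
   the points above the plane are thus at height at most 4 R_A; those below are
   reflected in the plane. *)

Require Import Defs.
From mathcomp Require Import all_boot all_order all_algebra.
From mathcomp Require Import all_classical all_reals all_analysis.
From mathcomp Require Import ring lra.
Import Order.TTheory GRing.Theory Num.Theory.
Import numFieldNormedType.Exports.
Local Open Scope classical_set_scope.
Local Open Scope ring_scope.

Set Implicit Arguments.
Unset Strict Implicit.
Unset Printing Implicit Defensive.

(** * Staircase paths in the plane *)

(** Interior points of S may have vertical tangent planes, and no regularity of [u] is assumed. The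
    proof therefore never differentiates [u]. It uses that a vertical line meets S at most once, and
    derives from this that near an interior point S covers a neighbourhood of the projection and has
    a well-defined side under it, even where the tangent plane is vertical. The region under the
    graph has no floor: it contains the whole vertical ray below each point of S, which keeps it
    closed. The plane z = 0 intervenes only by ensuring that the points of S with z > 0 are
    interior. The wall below a path is handled without the Jordan curve theorem: paths run parallel
    to the axes, and a parity of crossings tells their two sides apart. Each contact comes from two
    successive maximizations over a compact set of pairs (position of the moving body, point of
    space), first of the position, then of one coordinate of the contact points. Coincidence near
    the contact yields another contact at which this coordinate is larger. *)

Definition between (R : realType) (a b t : R) : Prop :=
  a <= t <= b \/ b <= t <= a.

(** Edges parallel to the axes suffice to join the points of a component of an open set, and
    crossings with them are decided by comparing coordinates. *)
Inductive staircase (R : realType) (E : R -> R -> Prop) (a b : R) :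
    R -> R -> Prop :=
| staircase0 : staircase E a b a b
| staircase_h x y x' : staircase E a b x y ->
    (forall t, between x x' t -> E t y) -> staircase E a b x' y
| staircase_v x y y' : staircase E a b x y ->
    (forall t, between y y' t -> E x t) -> staircase E a b x y'.

Lemma between_sym (R : realType) (a b t : R) : between a b t -> between b a t.
Proof. by rewrite /between; tauto. Qed.

Lemma staircase_trans (R : realType) (E : R -> R -> Prop) (a b c d x y : R) :
  staircase E a b c d -> staircase E c d x y -> staircase E a b x y.
Proof.
move=> abcd; elim=> [//|{}x {}y x' _ IH Exx'|{}x {}y y' _ IH Eyy'].
- exact: staircase_h IH Exx'.
- exact: staircase_v IH Eyy'.
Qed.

Lemma staircase_sym (R : realType) (E : R -> R -> Prop) (a b x y : R) :
  staircase E a b x y -> staircase E x y a b.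
Proof.
elim=> [|{}x {}y x' _ IH Exx'|{}x {}y y' _ IH Eyy']; first exact: staircase0.
- apply: staircase_trans IH; apply: staircase_h (staircase0 _ _ _) _ => t.
  by move/between_sym; exact: Exx'.
- apply: staircase_trans IH; apply: staircase_v (staircase0 _ _ _) _ => t.
  by move/between_sym; exact: Eyy'.
Qed.

Lemma staircase_end (R : realType) (E : R -> R -> Prop) (a b x y : R) :
  E a b -> staircase E a b x y -> E x y.
Proof.
move=> Eab; elim=> [//|{}x {}y x' _ _|{}x {}y y' _ _]; apply.
- by rewrite /between lexx; case: (leP x x') => ?; [left|right; lra].
- by rewrite /between lexx; case: (leP y y') => ?; [left|right; lra].
Qed.

Definition close (R : realType) (d a b : R) : Prop := a - d < b < a + d.

Definition corner (R : realType) (a b x y : R) : bool := (a <= x) && (y < b).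

Definition open_plane (R : realType) (P : R -> R -> Prop) : Prop :=
  forall x y, P x y -> exists2 d, 0 < d &
    forall x' y', x - d < x' < x + d -> y - d < y' < y + d -> P x' y'.

Lemma open_planeI (R : realType) (P Q : R -> R -> Prop) :
  open_plane P -> open_plane Q -> open_plane (fun x y => P x y /\ Q x y).
Proof.
move=> oP oQ x y [/oP[d d0 dP] /oQ[e e0 eQ]].
exists (Num.min d e) => [|x' y']; first by rewrite lt_min d0.
by case: (leP d e) => ? ? ?; split; [apply: dP|apply: eQ|apply: dP|apply: eQ]; lra.
Qed.

Lemma open_plane_ext (R : realType) (P Q : R -> R -> Prop) :
  (forall x y, P x y <-> Q x y) -> open_plane P -> open_plane Q.
Proof.
move=> PQ oP x y /PQ/oP[d d0 dP]; exists d => // x' y' hx hy.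
by apply/PQ; exact: dP.
Qed.

Lemma open_plane_swap (R : realType) (P : R -> R -> Prop) :
  open_plane P -> open_plane (fun x y => P y x).
Proof. by move=> oP x y /oP[d d0 dP]; exists d => // x' y' ? ?; exact: dP. Qed.

Lemma open_plane_segment (R : realType) (a b c : R) :
  open_plane (fun x y => ~ (y = c /\ between a b x)).
Proof.
move=> x y nS.
have [yc|yc|yc] := ltgtP y c.
- by exists (c - y) => [|x' y' _ h [e _]]; lra.
- by exists (y - c) => [|x' y' _ h [e _]]; lra.
have : (x < a /\ x < b) \/ (a < x /\ b < x).
  have [?|?] := ltP x a; have [?|?] := ltP x b.
  - by left.
  - by exfalso; apply: nS; split=> //; right; lra.
  - by exfalso; apply: nS; split=> //; left; lra.
  - have [?|?] := ltP a x; have [?|?] := ltP b x; first by right.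
    + by exfalso; apply: nS; split=> //; left; lra.
    + by exfalso; apply: nS; split=> //; right; lra.
    + by exfalso; apply: nS; split=> //; left; lra.
case=> -[xa xb].
- exists (Num.min (a - x) (b - x)) => [|x' y']; first by rewrite lt_min; lra.
  by case: (leP (a - x) (b - x)) => ? h _ [_]; rewrite /between => ?; lra.
- exists (Num.min (x - a) (x - b)) => [|x' y']; first by rewrite lt_min; lra.
  by case: (leP (x - a) (x - b)) => ? h _ [_]; rewrite /between => ?; lra.
Qed.

(* The parity function is the mod 2 winding number around the closed curve
   formed by the staircase and the two downward vertical rays from its ends,
   which [corner] accounts for: it is constant on horizontal segments that
   avoid the staircase, and so is its sum with the two corners on vertical
   ones. *)
Lemma staircase_parity (R : realType) (E : R -> R -> Prop) (a b c d : R) :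
  staircase E a b c d ->
  exists (G : R -> R -> Prop) (m : R -> R -> bool) (M : R),
    [/\ forall x y, G x y -> E x y,
        open_plane (fun x y => ~ G x y),
        forall x x' y, (forall t, between x x' t -> ~ G t y) -> m x y = m x' y,
        forall x y y', (forall t, between y y' t -> ~ G x t) ->
          m x y (+) corner a b x y (+) corner c d x y =
          m x y' (+) corner a b x y' (+) corner c d x y' &
        forall x y, y < - M \/ M < y -> m x y = false].
Proof.
elim=> [|x0 y0 x1 _ [G [m [M [GE Gcl Hm Vm far]]]] Ex|
         x0 y0 y1 _ [G [m [M [GE Gcl Hm Vm far]]]] Ey].
- exists (fun _ _ => False), (fun _ _ => false), 0; split=> //.
  + by move=> x y _; exists 1 => [|x' y' _ _ []]; rewrite ?ltr01.
  + by move=> x y y' _; rewrite /= !addbb.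
- exists (fun x y => G x y \/ y = y0 /\ between x0 x1 x), m, M; split=> //.
  + by move=> x y [/GE //|[-> /Ex]].
  + apply: (open_plane_ext _ (open_planeI Gcl (@open_plane_segment R x0 x1 y0))).
    by move=> x y; tauto.
  + by move=> x x' y h; apply: Hm => t /h nG ?; apply: nG; left.
  + move=> x y y' h.
    have := Vm x y y' (fun t ht Gt => h t ht (or_introl Gt)).
    (* The end moves from [x0] to [x1]. The identity could fail only if [x] separates [x0] from [x1]
       and [y0] separates [y] from [y']; the vertical segment would then cross the new edge. *)
    suff : corner x1 y0 x y (+) corner x1 y0 x y' = corner x0 y0 x y (+) corner x0 y0 x y'.
      do 6 case: (corner _ _ _ _) => //=; by case: (m x y); case: (m x y').
    rewrite /corner; have [->//|yy] := eqVneq (y < y0) (y' < y0); first by rewrite !addbb.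
    suff -> : (x0 <= x) = (x1 <= x) by [].
    apply: contrapT => xx; apply: (h y0); first by rewrite /between; move: yy; case: (ltP y y0); case: (ltP y' y0) => //= *; lra.
    by right; split=> //; move: xx; rewrite /between; case: (leP x0 x); case: (leP x1 x) => //= *; lra.
(* The added term is 1 exactly when the leftward ray from [(x, y)] meets the new vertical edge,
   half-open in [y] so that a vertex common to two edges is counted once. Thus [m] counts, mod 2,
   the vertical edges to the left. *)
- exists (fun x y => G x y \/ x = x0 /\ between y0 y1 y),
    (fun x y => m x y (+) (corner x0 y0 x y (+) corner x0 y1 x y)), (Num.max M (Num.max `|y0| `|y1|)); split.
  + by move=> x y [/GE //|[-> /Ey]].
  + apply: (open_plane_ext _ (open_planeI Gcl (open_plane_swap (@open_plane_segment R y0 y1 x0)))).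
    by move=> x y; tauto.
  + move=> x x' y h; rewrite (Hm x x' y); last by move=> t /h nG ?; apply: nG; left.
    congr (_ (+) _); rewrite /corner; have [->//|yy] := eqVneq (y < y0) (y < y1); first by rewrite !addbb.
    suff -> : (x0 <= x) = (x0 <= x') by [].
    apply: contrapT => xx; apply: (h x0).
      by move: xx; rewrite /between; case: (leP x0 x); case: (leP x0 x') => //= *; lra.
    by right; split=> //; move: yy; rewrite /between; case: (ltP y y0); case: (ltP y y1) => //= *; lra.
  + move=> x y y' h.
    have := Vm x y y' (fun t ht Gt => h t ht (or_introl Gt)).
    by do 6 case: (corner _ _ _ _) => //=; case: (m x y); case: (m x y').
  + move=> x y h; rewrite far; last first.
      by move: h; case: (leP `|y0| `|y1|) => ?; [case: (leP M `|y1|)|case: (leP M `|y0|)] => ? h; lra.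
    rewrite /corner; suff -> : (y < y0) = (y < y1) by rewrite addbb.
    have := ler_norm y0; have := ler_norm y1; have := ler_norm (- y0); have := ler_norm (- y1).
    rewrite !normrN; move: h; case: (leP `|y0| `|y1|) => ?; [case: (leP M `|y1|)|case: (leP M `|y0|)] => ? h ? ? ? ?;
    by case: (ltP y y0) => ?; case: (ltP y y1) => //= ?; lra.
Qed.

(** In the strip a < x < c the corner at [(a, b)] depends on [y] alone and the one at [(c, d)]
    vanishes. So [front], the parity with both corners, is constant along horizontal and vertical
    segments that avoid [S]; far away only [y < b] remains of it, which tells low from high. *)
Lemma staircase_separates (R : realType) (E : R -> R -> Prop) (a b c d : R) :
  staircase E a b c d ->
  exists (S : R -> R -> Prop) (front : R -> R -> bool) (M : R),
    [/\ forall x y, S x y -> E x y,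
        forall x y, a < x < c -> ~ S x y -> exists2 e, 0 < e & forall x' y',
          close e x x' -> close e y y' ->
          [/\ a < x' < c, ~ S x' y' & front x' y' = front x y],
        forall x y, a < x < c -> M < y -> front x y = false &
        forall x y, a < x < c -> y < - M -> front x y].
Proof.
move=> /staircase_parity[S [m [M [SE Sopen Hm Vm far]]]].
pose front x y := m x y (+) corner a b x y (+) corner c d x y.
have corner_ab x y : a < x < c -> corner a b x y = (y < b).
  by move=> /andP[/ltW ax _]; rewrite /corner ax.
have corner_cd x y : a < x < c -> corner c d x y = false.
  by move=> /andP[_ xc]; rewrite /corner leNgt xc.
exists S, front, (`|M| + `|b|).
have Mb : [/\ M <= `|M| + `|b|, b <= `|M| + `|b| & - b <= `|M| + `|b|].
  have := (normr_ge0 M, normr_ge0 b, ler_norm M, ler_norm b, ler_norm (- b)).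
  by rewrite normrN => -[[[[? ?] ?] ?] ?]; split; lra.
case: Mb => M1 M2 M3; split=> // [x y axc /Sopen[e e0 eS]|x y axc My|x y axc My].
- exists (Num.min e (Num.min (x - a) (c - x))) => [|x' y'].
    by rewrite !lt_min e0 !subr_gt0.
  set e' := Num.min _ _.
  have ee : e' <= e by rewrite ge_min lexx.
  have ea : e' <= x - a by rewrite !ge_min lexx orbT.
  have ec : e' <= c - x by rewrite !ge_min lexx !orbT.
  move: e' ee ea ec => e' ee ea ec; rewrite /close => hx hy.
  have axc' : a < x' < c by lra.
  split=> //; first by apply: eS; lra.
  transitivity (front x' y).
    by apply: Vm => t; rewrite /between => ht; apply: eS; lra.
  rewrite /front !corner_ab ?corner_cd //; congr (_ (+) _ (+) _).
  by apply: Hm => t; rewrite /between => ht; apply: eS; lra.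
- rewrite /front far; last by right; lra.
  by rewrite corner_ab // corner_cd // ltNge (ltW (le_lt_trans M2 My)).
- rewrite /front far; last by left; lra.
  by rewrite corner_ab // corner_cd // (_ : y < b) //; lra.
Qed.

(** * Sweeping and reflection under a graph *)

(** The first variable is the position of a moving body, a dummy when nothing moves; the others are
    the coordinates of a point of space. *)
Definition open4 (R : realType) (P : R -> R -> R -> R -> Prop) : Prop :=
  forall a x y z, P a x y z -> exists2 d, 0 < d &
    forall a' x' y' z', close d a a' -> close d x x' -> close d y y' ->
      close d z z' -> P a' x' y' z'.

Lemma open4_open (R : realType) (P : R -> R -> R -> R -> Prop) :
  open4 P <-> open [set p : R * R * R * R | P p.1.1.1 p.1.1.2 p.1.2 p.2].
Proof.
rewrite openE; split=> [oP [[[a x] y] z] /= /oP[d d0 dP]|oP a x y z Pp].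
  rewrite /interior -nbhs_ballE; exists d => //= -[[[a' x'] y'] z'] [[[/= ha hx] hy] hz].
  by apply: dP; rewrite /close; move: ha hx hy hz; rewrite /ball /= !ltr_norml; lra.
have := oP (a, x, y, z) Pp; rewrite /interior -nbhs_ballE => -[d /= d0 dP].
exists d => // a' x' y' z' ha hx hy hz; apply: (dP (a', x', y', z')).
by move: ha hx hy hz; rewrite /close => *; split; [split; [split|]|]; rewrite /ball /= ltr_norml; lra.
Qed.

Lemma open4I (R : realType) (P Q : R -> R -> R -> R -> Prop) :
  open4 P -> open4 Q -> open4 (fun a x y z => P a x y z /\ Q a x y z).
Proof. by rewrite !open4_open => oP oQ; exact: openI. Qed.

Lemma open4U (R : realType) (P Q : R -> R -> R -> R -> Prop) :
  open4 P -> open4 Q -> open4 (fun a x y z => P a x y z \/ Q a x y z).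
Proof. by rewrite !open4_open => oP oQ; exact: openU. Qed.

(** Applied twice at each contact: for the extremal position of the body, then, with the first
    variable set equal to a coordinate, for an extremal contact point. *)
Lemma compact_max4 (R : realType) (P : R -> R -> R -> R -> Prop) (M : R) :
  (forall a x y z, P a x y z -> [/\ close M 0 a, close M 0 x, close M 0 y & close M 0 z]) ->
  open4 (fun a x y z => ~ P a x y z) ->
  (exists a x y z, P a x y z) ->
  exists a x y z, P a x y z /\ forall a' x' y' z', P a' x' y' z' -> a' <= a.
Proof.
move=> bP oP [a0 [x0 [y0 [z0 P0]]]].
pose A := [set p : R * R * R * R | P p.1.1.1 p.1.1.2 p.1.2 p.2].
have cA : compact A.
  apply: (@subclosed_compact _ _ (`[- M, M] `*` `[- M, M] `*` `[- M, M] `*` `[- M, M])).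
  - by move/open4_open : oP; rewrite -closedC; congr closed; apply/seteqP; split=> p /=; rewrite /A /=; [apply: contrapT|move=> ? ?].
  - by do 3 (apply: compact_setX; last exact: segment_compact); exact: segment_compact.
  - by move=> [[[a x] y] z] /bP[]; rewrite /close /= !in_itv /= => *; split; [split; [split|]|] => /=; lra.
have [|||[[[a x] y] z] /set_mem /= Pp Pmax] := @compact_EVT_max _ R (fun p => p.1.1.1) A.
- by exists (a0, x0, y0, z0).
- exact: cA.
- apply: continuous_subspaceT => p.
  by apply: (@cvg_comp _ _ _ (fun p : R * R * R * R => p.1.1) fst); [apply: (@cvg_comp _ _ _ (fun p : R * R * R * R => p.1) fst)|]; exact: cvg_fst.
exists a, x, y, z; split=> // a' x' y' z' P'.
by apply: (Pmax (a', x', y', z')); exact/mem_set.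
Qed.

Lemma open4_ball (R : realType) (b c r : R) :
  open4 (fun a x y z : R => ~ ((x - b) ^+ 2 + (y - a) ^+ 2 + (z - c) ^+ 2 <= r)).
Proof.
apply/open4_open; rewrite -closedC.
pose f (p : R * R * R * R) := (p.1.1.2 - b) * (p.1.1.2 - b) +
  (p.1.2 - p.1.1.1) * (p.1.2 - p.1.1.1) + (p.2 - c) * (p.2 - c).
rewrite (_ : ~` _ = f @^-1` [set x | x <= r]); last first.
  by apply/seteqP; split=> p /=; rewrite /f -!expr2; [apply: contrapT|move=> ? ?].
apply: closed_comp; last exact: closed_le.
move=> p _.
have c0 : (fun p : R * R * R * R => p.1.1.1) @ p --> p.1.1.1.
  by apply: (@cvg_comp _ _ _ (fun p : R * R * R * R => p.1.1) fst); [apply: (@cvg_comp _ _ _ (fun p : R * R * R * R => p.1) fst)|]; exact: cvg_fst.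
have c1 : (fun p : R * R * R * R => p.1.1.2) @ p --> p.1.1.2.
  by apply: (@cvg_comp _ _ _ (fun p : R * R * R * R => p.1.1) snd); [apply: (@cvg_comp _ _ _ (fun p : R * R * R * R => p.1) fst)|]; [exact: cvg_fst..|exact: cvg_snd].
have c2 : (fun p : R * R * R * R => p.1.2) @ p --> p.1.2.
  by apply: (@cvg_comp _ _ _ (fun p : R * R * R * R => p.1) snd); [exact: cvg_fst|exact: cvg_snd].
have c3 : (fun p : R * R * R * R => p.2) @ p --> p.2 by exact: cvg_snd.
by apply: cvgD; [apply: cvgD|]; apply: cvgM; apply: cvgB => //; exact: cvg_cst.
Qed.

(** A Lipschitz condition phrased through [close], so that for affine [f] it is plain linear
    arithmetic. *)
Lemma open4_lt (R : realType) (f : R -> R -> R -> R -> R) (K : R) :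
  (forall d a a' x x' y y' z z', close d a a' -> close d x x' -> close d y y' ->
     close d z z' -> close (K * d) (f a x y z) (f a' x' y' z')) ->
  open4 (fun a x y z => f a x y z < 0).
Proof.
move=> hf a x y z f0; have [K0|K0] := ltP 0 K.
  exists (- f a x y z / K) => [|a' x' y' z' ha hx hy hz].
    by rewrite divr_gt0 //; lra.
  by have := hf _ _ _ _ _ _ _ _ _ ha hx hy hz; rewrite /close [K * _]mulrC divfK ?gt_eqF //; lra.
exists 1 => [//|a' x' y' z' ha hx hy hz].
by have := hf _ _ _ _ _ _ _ _ _ ha hx hy hz; rewrite /close mulr1; lra.
Qed.

Lemma sqr_le_range (R : realType) (r t : R) :
  0 <= r -> t ^+ 2 <= r ^+ 2 -> - r <= t <= r.
Proof.
by move=> r0; rewrite -ler_norml -[t ^+ 2]real_normK ?num_real // ler_sqr ?nnegrE.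
Qed.

(** * The height bound for an abstract graph, given as a set of triples *)

Section Core.
Variables (R : realType) (G : R -> R -> R -> Prop) (r : R).

Definition under x y z : Prop := exists2 t, 0 <= t & G x y (z + t).
Definition below x y z : Prop := exists2 t, 0 < t & G x y (z + t).

Hypothesis r_gt0 : 0 < r.
Hypothesis G_bounded : exists M, forall x y z, G x y z ->
  [/\ close M 0 x, close M 0 y & close M 0 z].
Hypothesis under_closed : open4 (fun _ x y z => ~ under x y z).
Hypothesis G_unique : forall x y z z', G x y z -> G x y z' -> z = z'.
Hypothesis G_open : forall x y z e, G x y z -> 0 < z -> 0 < e ->
  exists2 d, 0 < d & forall x' y', close d x x' -> close d y y' ->
    exists2 z', close e z z' & G x' y' z'.
(** The maximum principle in its two uses, for a ball here and for a reflected copy of the region in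
    [G_reflection]: a local inclusion under the graph forces local coincidence, expressed on graph
    points only. *)
Hypothesis G_sphere : forall a b c x y z, G x y z -> 0 < z ->
  (x - a) ^+ 2 + (y - b) ^+ 2 + (z - c) ^+ 2 = r ^+ 2 ->
  (exists2 d, 0 < d & forall x' y' z', close d x x' -> close d y y' ->
     close d z z' -> (x' - a) ^+ 2 + (y' - b) ^+ 2 + (z' - c) ^+ 2 <= r ^+ 2 ->
     under x' y' z') ->
  exists2 d, 0 < d & forall x' y' z', close d x x' -> close d y y' ->
     close d z z' -> G x' y' z' ->
     (x' - a) ^+ 2 + (y' - b) ^+ 2 + (z' - c) ^+ 2 = r ^+ 2.
Hypothesis G_reflection : forall s k x y z, G x y z -> 0 < z ->
  G (z - s) y (x + k) -> 0 < x + k ->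
  (exists2 d, 0 < d & forall x' y' z', close d x x' -> close d y y' ->
     close d z z' -> under x' y' z' -> under (z' - s) y' (x' + k)) ->
  exists2 d, 0 < d & forall x' y' z', close d (z - s) x' -> close d y y' ->
     close d (x + k) z' -> G x' y' z' -> G (z' - k) y' (x' + s).

Lemma not_under_G x y z t : G x y z -> 0 < t -> ~ under x y (z + t).
Proof. by move=> Gz t0 [u u0 Gu]; have := G_unique Gz Gu; lra. Qed.

Lemma not_below_G x y z : G x y z -> ~ below x y z.
Proof. by move=> Gz [u u0 Gu]; have := G_unique Gz Gu; lra. Qed.

Lemma under_not_below x y z : under x y z -> ~ below x y z -> G x y z.
Proof.
case=> t; rewrite le_eqVlt => /orP[/eqP <-|t0 Gt nb]; first by rewrite addr0.
by case: nb; exists t.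
Qed.

Lemma below_under x y z : below x y z -> under x y z.
Proof. by case=> t /ltW; exists t. Qed.

Lemma below_open : open4 (fun _ x y z => 0 < z /\ below x y z).
Proof.
move=> a x y z [z0 [t t0 Gt]].
have [||d d0 Hd] := @G_open x y (z + t) (t / 2) Gt; [lra..|].
exists (Num.min d (Num.min z (t / 2))) => [|a' x' y' z' _].
  by rewrite !lt_min d0 z0; lra.
have ? : Num.min d (Num.min z (t / 2)) <= d by rewrite ge_min lexx.
have ? : Num.min d (Num.min z (t / 2)) <= z by rewrite !ge_min lexx orbT.
have ? : Num.min d (Num.min z (t / 2)) <= t / 2 by rewrite !ge_min lexx !orbT.
rewrite /close => hx hy hz; split; first by lra.
have [||z'' hz'' Gz''] := Hd x' y'; rewrite /close; [lra..|].
exists (z'' - z'); last by rewrite addrC subrK.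
by move: hz''; rewrite /close; lra.
Qed.

Definition above (t0 x y : R) : Prop := exists2 z, t0 < z & G x y z.

Lemma above_open t0 : 0 <= t0 -> open_plane (above t0).
Proof.
move=> t00 x y [z tz Gz].
have [||d d0 Hd] := @G_open x y z (z - t0) Gz; [lra..|].
exists d => // x' y' hx hy; have [z' hz' Gz'] := Hd x' y' hx hy.
by exists z' => //; move: hz'; rewrite /close; lra.
Qed.

Lemma open4_plane (P : R -> R -> Prop) :
  open_plane P -> open4 (fun _ x y _ => P x y).
Proof.
by move=> oP a x y z /oP[d d0 dP]; exists d => // ? x' y' ? _ hx hy _; exact: dP.
Qed.

Lemma open4_slice (P : R -> R -> R -> R -> Prop) (c : R) :
  open4 P -> open4 (fun _ x y z => P c x y z).
Proof.
move=> oP a x y z /oP[d d0 dP]; exists d => // ? x' y' z' _ hx hy hz.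
by apply: dP => //; rewrite /close; lra.
Qed.

Lemma ball_range (p q e x y z : R) :
  (x - p) ^+ 2 + (y - e) ^+ 2 + (z - q) ^+ 2 <= r ^+ 2 ->
  [/\ p - r <= x <= p + r, e - r <= y <= e + r & q - r <= z <= q + r].
Proof.
move=> h; have := sqr_ge0 (x - p); have := sqr_ge0 (y - e); have := sqr_ge0 (z - q).
move=> *; have range t : t ^+ 2 <= r ^+ 2 -> - r <= t <= r.
  by apply: sqr_le_range; exact: ltW.
have hx : - r <= x - p <= r by apply: range; lra.
have hy : - r <= y - e <= r by apply: range; lra.
have hz : - r <= z - q <= r by apply: range; lra.
by split; lra.
Qed.

(** First contact of a ball that moves towards smaller y. Since [under] is closed, the ball at [e]
    is still under the graph near the contact, so nearby graph points lie on the sphere; a graph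
    point over [(x + k, y)] then contradicts the choice of [x]. *)
Lemma ball_contact (F : R -> R -> Prop) (p q e x y z : R) :
  (x - p) ^+ 2 + (y - e) ^+ 2 + (z - q) ^+ 2 <= r ^+ 2 -> 0 < z -> ~ below x y z ->
  (exists2 d, 0 < d & forall x' y', close d x x' -> close d y y' -> F x' y') ->
  (forall e' x' y' z', e < e' -> F x' y' -> 0 < z' ->
     (x' - p) ^+ 2 + (y' - e') ^+ 2 + (z' - q) ^+ 2 <= r ^+ 2 -> under x' y' z') ->
  (forall x' y' z', F x' y' -> G x' y' z' ->
     (x' - p) ^+ 2 + (y' - e) ^+ 2 + (z' - q) ^+ 2 <= r ^+ 2 -> x' <= x) ->
  False.
Proof.
move=> ball z0 nbelow [d d0 dF] inside xmax.
have [_ _ hz] := ball_range ball.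
have local_under : exists2 f, 0 < f & forall x' y' z', close f x x' -> close f y y' ->
     close f z z' -> (x' - p) ^+ 2 + (y' - e) ^+ 2 + (z' - q) ^+ 2 <= r ^+ 2 ->
     under x' y' z'.
  exists (Num.min d z / 2) => [|x' y' z']; first by rewrite divr_gt0 // lt_min d0.
  have fd : Num.min d z <= d by rewrite ge_min lexx.
  have fz : Num.min d z <= z by rewrite ge_min lexx orbT.
  move: (Num.min d z) fd fz => f fd fz.
  rewrite /close => hx hy hz' hb; apply: contrapT => nu.
  have [f' f'0 nf] := @under_closed 0 x' y' z' nu.
  pose g := Num.min f' d / 2.
  have g0 : 0 < g by rewrite divr_gt0 // lt_min f'0.
  have gf : g <= f' / 2 by rewrite /g ler_pM2r // ge_min lexx.
  have gd : g <= d / 2 by rewrite /g ler_pM2r // ge_min lexx orbT.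
  move: g g0 gf gd => g g0 gf gd.
  (* The point shifted by [g] in the y-direction lies in the ball at [e + g], hence under the graph,
     although [nf] excludes all points this close. *)
  apply: (nf 0 x' (y' + g) z'); rewrite /close; [lra|lra|lra|lra|].
  apply: (inside (e + g)); [lra|by apply: dF; rewrite /close; lra|lra|].
  by rewrite [y' + g - _](_ : _ = y' - e) //; ring.
have refl_close u f : 0 < f -> close f u u by rewrite /close => ?; lra.
have uxyz : under x y z by case: local_under => f f0; apply=> //; exact: refl_close.
have Gxyz : G x y z by exact: under_not_below.
have on_sphere : (x - p) ^+ 2 + (y - e) ^+ 2 + (z - q) ^+ 2 = r ^+ 2.
  apply/eqP; rewrite eq_le ball leNgt; apply/negP => hlt.
  have [f f0 fu] := local_under.
  pose gap := r ^+ 2 - ((x - p) ^+ 2 + (y - e) ^+ 2 + (z - q) ^+ 2).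
  have gap0 : 0 < gap by rewrite subr_gt0.
  have r1 : 0 < 2 * r + 1 by rewrite ltr_wpDl // mulr_ge0 // ltW.
  (* Raising the point by [g <= 1] adds at most [g * (2 * r + 1)] to the squared distance, as
     [z - q <= r]. From inside the ball, the raised point would still be in it, hence under the
     graph, while it is above a graph point. *)
  pose g := Num.min (Num.min (f / 2) 1) (gap / (2 * r + 1)).
  have g0 : 0 < g by rewrite !lt_min ltr01 !divr_gt0.
  have gf : g <= f / 2 by rewrite !ge_min lexx.
  have g1 : g <= 1 by rewrite !ge_min lexx orbT.
  have hg : g * (2 * r + 1) <= gap by rewrite -ler_pdivlMr ?ge_min ?lexx ?orbT.
  move: g g0 gf g1 hg => g g0 gf g1 hg.
  apply: (@not_under_G x y z g) => //.
  apply: fu; [exact: refl_close|exact: refl_close|rewrite /close; lra|].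
  have : (z + g - q) ^+ 2 <= (z - q) ^+ 2 + g * (2 * r + 1) by nra.
  by move: hg; rewrite /gap => *; lra.
have [f f0 fsphere] := G_sphere Gxyz z0 on_sphere local_under.
pose g := Num.min f d.
have g0 : 0 < g by rewrite lt_min f0.
have gf : g <= f by rewrite ge_min lexx.
have gd : g <= d by rewrite ge_min lexx orbT.
have [h h0 Hh] := G_open Gxyz z0 g0.
pose k := Num.min g h / 2.
have k0 : 0 < k by rewrite divr_gt0 // lt_min g0.
have kg : k <= g / 2 by rewrite /k ler_pM2r // ge_min lexx.
have kh : k <= h / 2 by rewrite /k ler_pM2r // ge_min lexx orbT.
move: g k g0 gf gd Hh k0 kg kh => g k g0 gf gd Hh k0 kg kh.
have [||z' hz' Gz'] := Hh (x + k) y; [by rewrite /close; lra|exact: refl_close|].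
have cx c : g <= c -> close c x (x + k) by rewrite /close => gc; lra.
have : x + k <= x.
  apply: (xmax _ y z') => //; first by apply: dF; [exact: cx|exact: refl_close].
  rewrite fsphere //; [exact: cx|exact: refl_close|].
  by move: hz'; rewrite /close; lra.
by lra.
Qed.

Lemma width_above (t0 a b c d : R) : 2 * r < t0 ->
  above t0 a b -> staircase (above t0) a b c d -> c <= a + 2 * r.
Proof.
move=> t0r Eab st; rewrite leNgt; apply/negP => ac.
have [S [front [M [SE front_cst front_high front_low]]]] := staircase_separates st.
have [N GN] := G_bounded.
(* The centre is midway between the ends of the path and between the heights 0 and [t0], so the ball
   has room on all four sides. *)
pose p := (a + c) / 2; pose q := t0 / 2.
have [pa pc qr qt] : [/\ a < p - r, p + r < c, 0 < q - r & q + r < t0].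
  by have r0 := r_gt0; rewrite /p /q; split; lra.
have aqc : a < p < c by have r0 := r_gt0; lra.
have [K [KM KN K0]] : exists K, [/\ M < K, N < K & 0 < K].
  exists (`|M| + `|N| + 1).
  have := (normr_ge0 M, normr_ge0 N, ler_norm M, ler_norm N).
  by move=> -[[[? ?] ?] ?]; split; lra.
(* Bad points of the ball at [e]: on the wall or in front of it, and not strictly under the graph at
   positive height. The ball comes from large y, so the largest [e] with a bad point is the first
   contact. Behind the wall the ball may stick out of the region. *)
pose P (e x y z : R) := [/\ - K <= e,
  (x - p) ^+ 2 + (y - e) ^+ 2 + (z - q) ^+ 2 <= r ^+ 2,
  ~ (~ S x y /\ front x y = false) & ~ (0 < z /\ below x y z)].
have strip e x y z : (x - p) ^+ 2 + (y - e) ^+ 2 + (z - q) ^+ 2 <= r ^+ 2 ->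
    a < x < c /\ 0 < z < t0.
  by case/ball_range => hx _ hz; split; lra.
have P_low e x y z : P e x y z -> y <= K.
  move=> [_ /strip[axc _] nF _]; rewrite leNgt; apply/negP => yK; apply: nF; split.
    by move=> /SE[z' _ /GN[_ + _]]; rewrite /close => ?; lra.
  by apply: front_high => //; lra.
have P_bounded : exists B, forall e x y z, P e x y z ->
    [/\ close B 0 e, close B 0 x, close B 0 y & close B 0 z].
  exists (`|a| + `|c| + K + r + r + t0 + 1) => e x y z Pe.
  have yK := P_low _ _ _ _ Pe; case: Pe => eK hb _ _.
  have [axc zt] := strip _ _ _ _ hb; case/ball_range: hb => _ hy _.
  have r0 := r_gt0.
  have := (normr_ge0 a, normr_ge0 c, ler_norm (- a), ler_norm c); rewrite normrN.
  move=> -[[[? ?] ?] ?]; rewrite /close.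
  by split; lra.
have P_closed : open4 (fun e x y z => ~ P e x y z).
  suff : open4 (fun e x y z => ((e < - K \/
      ~ ((x - p) ^+ 2 + (y - e) ^+ 2 + (z - q) ^+ 2 <= r ^+ 2)) \/
      ((a < x < c /\ ~ S x y) /\ front x y = false)) \/ (0 < z /\ below x y z)).
    move=> oP e x y z nP; have [|f f0 fP] := oP e x y z.
      apply: contrapT => nQ; apply: nP; split.
      - by rewrite leNgt; apply/negP => ?; apply: nQ; do 3 left.
      - by apply: contrapT => ?; apply: nQ; left; left; right.
      - move=> nS; apply: nQ; case: nS => nS nf.
        apply: contrapT => nQ; apply: nQ.
        have [hb|hb] := pselect ((x - p) ^+ 2 + (y - e) ^+ 2 + (z - q) ^+ 2 <= r ^+ 2); last by left; left; right.
        by have [axc _] := strip _ _ _ _ hb; left; right.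
      - by move=> ?; apply: nQ; right.
    exists f => // e' x' y' z' he hx hy hz [P1 P2 P3 P4].
    case: (fP e' x' y' z' he hx hy hz) => [[[|//]|[[_ nS] nf]]|//]; first by lra.
    by apply: P3.
  apply: open4U; last exact: below_open.
  apply: open4U.
    apply: open4U; last exact: open4_ball.
    by move=> e x y z h; exists (- K - e); rewrite /close; [lra|move=> e' *; lra].
  apply: open4_plane => x y [[axc nS] nf]; have [e e0 eP] := front_cst x y axc nS.
  exists e => // x' y' hx hy; have [? ? ->] := eP x' y' hx hy.
  by [].
have P_nonempty : exists e x y z, P e x y z.
  (* At [e = - K] the centre is in front of the wall and has no graph point over it. *)
  exists (- K), p, (- K), q; split=> //.
  - by rewrite !subrr expr0n /= !addr0 sqr_ge0.
  - by move=> [_]; rewrite front_low //; lra.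
  - by move=> [_ [t _ /GN[_ + _]]]; rewrite /close => ?; lra.
have [B PB] := P_bounded.
have [e0 [x1 [y1 [z1 [P1 Pmax]]]]] := compact_max4 PB P_closed P_nonempty.
have [|||_ [x [y [z [[-> Px] Pxmax]]]]] := @compact_max4 R (fun e x y z => e = x /\ P e0 x y z) B.
- by move=> e x y z [-> /PB[]].
- suff : open4 (fun e x y z => (e <> x) \/ ~ P e0 x y z).
    move=> oP e x y z nP; have [|f f0 fP] := oP e x y z; first by move/not_andP: nP.
    by exists f => // e' x' y' z' he hx hy hz; apply/not_andP; exact: fP.
  apply: open4U; last exact: (@open4_slice (fun e x y z => ~ P e x y z)).
  move=> e x y z /eqP; rewrite neq_lt => /orP[ex|ex].
    by exists ((x - e) / 2) => [|e' x' ? ?]; rewrite /close; lra.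
  by exists ((e - x) / 2) => [|e' x' ? ?]; rewrite /close; lra.
- by exists x1, x1, y1, z1.
have [e0K hball nF nW] := Px; have [axc /andP[z0 zt]] := strip _ _ _ _ hball.
(* Over the wall the graph is higher than [t0], and the ball stays below [t0]: no contact occurs
   there. *)
have nS : ~ S x y.
  move=> /SE[t tt Gt]; apply: nW; split=> //; exists (t - z); last by rewrite addrC subrK.
  by rewrite subr_gt0 (lt_trans zt).
have Fxy : front x y = true.
  by apply: contrapT => /negP/negbTE nf; apply: nF.
apply: (@ball_contact (fun x y => ~ S x y /\ front x y) p q e0 x y z) => //.
- by move=> bl; apply: nW.
- have [f f0 Hf] := front_cst x y axc nS; exists f => // x' y' hx hy.
  by have [_ ? ->] := Hf x' y' hx hy.
- move=> e' x' y' z' ee [nS' F'] z'0 hb; apply: contrapT => nu.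
  have /Pmax : P e' x' y' z'.
    split=> //; first exact: le_trans (ltW ee).
      by rewrite F' => -[].
    by move=> [_ /below_under].
  by rewrite leNgt ee.
- move=> x' y' z' [nS' F'] G' hb; apply: (Pxmax _ x' y' z'); split=> //; split=> //.
    by rewrite F' => -[].
  by move=> [_ /(not_below_G G')].
Qed.

Lemma staircase_open (E : R -> R -> Prop) a b :
  open_plane E -> E a b -> open_plane (staircase E a b).
Proof.
move=> oE Eab x y st; have [d d0 dE] := oE _ _ (staircase_end Eab st).
exists d => // x' y' hx hy.
apply: (@staircase_v _ _ _ _ _ y); last by move=> t; rewrite /between => ht; apply: dE; lra.
by apply: staircase_h st _ => t; rewrite /between => ht; apply: dE; lra.
Qed.

(** The component is also relatively closed, which lets [height_above] pass to limits inside it. *)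
Lemma staircase_closed (E : R -> R -> Prop) a b x y :
  open_plane E -> E x y ->
  (forall d, 0 < d -> exists x' y', [/\ close d x x', close d y y' & staircase E a b x' y']) ->
  staircase E a b x y.
Proof.
move=> oE Exy lim; have [d d0 dE] := oE _ _ Exy.
have [x' [y' [hx hy st]]] := lim d d0; rewrite /close in hx hy.
apply: (@staircase_v _ _ _ _ _ y').
  by apply: staircase_h st _ => t; rewrite /between => ht; apply: dE; lra.
by move=> t; rewrite /between => ht; apply: dE; lra.
Qed.

(** Same scheme as [ball_contact], the body being the image of the region by a glide reflection,
    with [s] decreasing. At the contact both the point and its image are on the graph, and graph
    points near the image are images of graph points. A graph point near the image but slightly
    further along x thus comes from one higher than [z]. *)
Lemma glide_contact (D : R -> R -> Prop) (t0 s e g x y z : R) :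
  0 <= t0 -> 0 < e -> 0 < g -> t0 + e <= x + s - e -> 0 < z ->
  (forall X Y, (forall d, 0 < d -> exists x' y', [/\ close d X x', close d Y y' & D x' y']) ->
     above t0 X Y -> D X Y) ->
  under x y z -> ~ (D (z - s) y /\ below (z - s) y (x + (s - e))) ->
  (forall x' y' z' t, close g x x' -> close g y y' -> close g z z' ->
     under x' y' z' -> 0 < t < g ->
     D (z' - (s + t)) y' /\ under (z' - (s + t)) y' (x' + (s + t) - e)) ->
  (forall x' y' z', close g x x' -> close g y y' -> close g z z' ->
     G x' y' z' -> G (z' - s) y' (x' + (s - e)) -> z' <= z) ->
  False.
Proof.
move=> t00 e0 g0 tZ z0 limD uxyz nW moved zmax.
have small d : 0 < d -> exists t, [/\ 0 < t, t < d & t < g].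
  move=> d0; exists (Num.min d g / 2); split; first by rewrite divr_gt0 // lt_min d0.
    by rewrite ltr_pdivrMr // (le_lt_trans (y := d)) ?ge_min ?lexx // ltr_pMr // ltr1n.
  by rewrite ltr_pdivrMr // (le_lt_trans (y := g)) ?ge_min ?lexx ?orbT // ltr_pMr // ltr1n.
have local_under x' y' z' : close g x x' -> close g y y' -> close g z z' ->
    under x' y' z' -> under (z' - s) y' (x' + (s - e)).
  move=> hx hy hz' u; apply: contrapT => nu; have [d d0 dU] := @under_closed 0 _ _ _ nu.
  have [t [t0' td tg]] := small d d0.
  have [|_] := moved x' y' z' t hx hy hz' u; first by rewrite t0'.
  by apply: (dU 0); rewrite /close; lra.
have refl_close (u f : R) : 0 < f -> close f u u by rewrite /close => ?; lra.
have uXYZ : under (z - s) y (x + (s - e)) by apply: local_under => //; exact: refl_close.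
have DXY : D (z - s) y.
  apply: limD; last by case: uXYZ => t tt Gt; exists (x + (s - e) + t) => //; lra.
  move=> d d0; have [t [t0' td tg]] := small d d0.
  have [D' _] := moved x y z t (refl_close _ _ g0) (refl_close _ _ g0)
    (refl_close _ _ g0) uxyz ltac:(by rewrite t0').
  by exists (z - (s + t)), y; split=> //; [rewrite /close; lra|exact: refl_close].
have GXYZ : G (z - s) y (x + (s - e)) by apply: under_not_below => // bl; apply: nW.
have Gxyz : G x y z.
  apply: under_not_below => // bl.
  have [d d0 dB] := @below_open 0 x y z (conj z0 bl); have [t [t0' td tg]] := small d d0.
  apply: (not_under_G GXYZ t0').
  rewrite [_ + t](_ : _ = x + t + (s - e)); last by ring.
  apply: local_under; try exact: refl_close; first by rewrite /close; lra.
  apply: below_under; have [_ bl'] : 0 < z /\ below (x + t) y z; last exact: bl'.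
  by apply: (dB 0); try exact: refl_close; rewrite /close; lra.
have xk : 0 < x + (s - e) by lra.
have [|d d0 dG] := G_reflection Gxyz z0 GXYZ xk; first by exists g.
have [f [f0 fd fg]] := small d d0.
have [d2 d20 Hd2] := G_open GXYZ xk f0.
have [k [k0 kd2 _]] := small (Num.min d2 f) ltac:(by rewrite lt_min d20).
move: kd2; rewrite lt_min => /andP[kd2 kf].
have [||Z hZ GZ] := Hd2 (z - s + k) y; [by rewrite /close; lra|exact: refl_close|].
(* The preimage of the new graph point has height [z + k]. *)
have G' : G (Z - (s - e)) y (z - s + k + s).
  apply: dG => //; [by rewrite /close; lra|exact: refl_close|].
  by move: hZ; rewrite /close => ?; lra.
have : z - s + k + s <= z.
  apply: (zmax _ y _ _ _ _ G'); [|exact: refl_close|by rewrite /close; lra|].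
    by move: hZ; rewrite /close => ?; lra.
  by move: GZ; congr G; ring.
by lra.
Qed.

(* The glide reflection (x, y, z) |-> (z - s, y, x + s - e), the reflection in
   the plane z = x + s followed by a small downward translation, maps the cut of
   the graph by this plane strictly under the graph: the first contact, as s
   decreases, is then between interior points. *)
Lemma height_above (t0 w a b h : R) : 0 <= t0 -> t0 < h -> G a b h ->
  (forall x y x' y', staircase (above t0) a b x y ->
     staircase (above t0) a b x' y' -> x' <= x + w) ->
  h <= t0 + w.
Proof.
move=> t00 t0h Gabh width; rewrite leNgt; apply/negP => hw.
have Eab : above t0 a b by exists h.
pose D := staircase (above t0) a b.
have oE := above_open t00; have oD : open_plane D := staircase_open oE Eab.
have DE x y : D x y -> above t0 x y := staircase_end Eab.
have Dab : D a b by exact: staircase0.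
have [l lD Dl] : exists2 l, forall x y, D x y -> l <= x & forall x y, D x y -> x <= l + w.
  pose X := [set x | exists y, D x y].
  have X0 : X !=set0 by exists a, b.
  have lX x y : D x y -> lbound X (x - w).
    by move=> Dxy x' [y' D']; have := width _ _ _ _ D' Dxy; lra.
  exists (inf X) => x y Dxy.
    by apply: ge_inf; [exists (a - w); exact: lX Dab|exists y].
  by have := lb_le_inf X0 (lX x y Dxy); lra.
(* For [s >= s1] and [x >= l] the image has height at least [t0 + e]. At [s1] the point of height
   [h] is above the mirror plane, and its image has first coordinate [l + w + e], outside the
   component. *)
pose e := (h - t0 - w) / 3; have e0 : 0 < e.
  by rewrite /e; lra.
pose s1 := t0 - l + 2 * e.
pose lim x y := forall d, 0 < d -> exists x' y', [/\ close d x x', close d y y' & D x' y'].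
pose W x y z := D x y /\ t0 < z /\ below x y z.
have limD x y : lim x y -> above t0 x y -> D x y by move=> ? ?; exact: staircase_closed.
have D_lim x y : D x y -> lim x y.
  by move=> Dxy d d0; exists x, y; split=> //; rewrite /close; lra.
have lim_ge x y : lim x y -> l <= x.
  move=> lxy; rewrite leNgt; apply/negP => xl; have [|x' [y' [hx _ /lD]]] := lxy (l - x); first by lra.
  by move: hx; rewrite /close; lra.
have lim_closed : open_plane (fun x y => ~ lim x y).
  move=> x y /existsNP[d] /not_implyP[d0 nd]; exists (d / 2) => [|x' y' hx hy lim']; first by lra.
  have [|x2 [y2 [hx2 hy2 D2]]] := lim' (d / 2); first by lra.
  by apply: nd; exists x2, y2; move: hx2 hy2; rewrite /close => *; split=> //; lra.
have W_open : open4 (fun _ x y z => W x y z).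
  apply: open4I; first exact: open4_plane.
  move=> c x y z [tz bz]; have [|d d0 dB] := @below_open c x y z; first by split=> //; lra.
  exists (Num.min d (z - t0)) => [|c' x' y' z']; first by rewrite lt_min d0; lra.
  have ? : Num.min d (z - t0) <= d by rewrite ge_min lexx.
  have ? : Num.min d (z - t0) <= z - t0 by rewrite ge_min lexx orbT.
  rewrite /close => hc hx hy hz; split; first by lra.
  by have [||||_ bl] := dB c' x' y' z'; rewrite /close; [lra..|].
(* Bad points: under the graph, above the mirror plane, over the closure of the component, with an
   image that is not strictly under the part of the graph over the component. The closure [lim]
   makes this set closed; by [PD] the points are over the component itself. *)
pose P s x y z := [/\ s1 <= s, x + s <= z, under x y z, lim x y & ~ W (z - s) y (x + s - e)].
have PD s x y z : P s x y z -> D x y /\ t0 + e + e <= z.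
  move=> [hs hz [t tt Gt] lxy _]; have := lim_ge _ _ lxy; rewrite /s1 in hs => ?.
  by split; [apply: limD => //; exists (z + t) => //; lra|lra].
have P_bounded : exists K, forall s x y z, P s x y z ->
    [/\ close K 0 s, close K 0 x, close K 0 y & close K 0 z].
  have [N GN] := G_bounded; exists (N + N + `|s1| + `|t0|) => s x y z Ps.
  have [_ tz] := PD _ _ _ _ Ps; case: Ps => hs hz [t tt /GN[hx hy hzt]] _ _.
  have := (ler_norm (- s1), normr_ge0 s1, ler_norm (- t0), normr_ge0 t0).
  rewrite !normrN; move: hx hy hzt; rewrite /close => ? ? ? [[[? ?] ?] ?].
  by split; lra.
have P_closed : open4 (fun s x y z => ~ P s x y z).
  suff : open4 (fun s x y z => (((s - s1 < 0 \/ z - x - s < 0) \/ ~ under x y z) \/ ~ lim x y) \/ W (z - s) y (x + s - e)).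
    move=> oP s x y z nP; have [|d d0 dP] := oP s x y z.
      apply: contrapT => nQ; apply: nP; split.
      - by rewrite leNgt; apply/negP => ?; apply: nQ; do 4 left; lra.
      - by rewrite leNgt; apply/negP => ?; apply: nQ; do 3 left; right; lra.
      - by apply: contrapT => ?; apply: nQ; do 2 left; right.
      - by apply: contrapT => ?; apply: nQ; left; right.
      - by move=> ?; apply: nQ; right.
    exists d => // s' x' y' z' hs hx hy hz [P1 P2 P3 P4 P5].
    by case: (dP s' x' y' z' hs hx hy hz) => [[[[]|]|]|] //; lra.
  apply: open4U.
    apply: open4U; last exact: open4_plane.
    apply: open4U; last exact: under_closed.
    by apply: open4U; [apply: (open4_lt (K := 1))|apply: (open4_lt (K := 3))]; move=> d s s' x x' y y' z z'; rewrite /close; lra.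
  move=> s x y z /(W_open 0)[d d0 dW]; exists (d / 2) => [|s' x' y' z' hs hx hy hz]; first by lra.
  by apply: (dW 0); move: hs hx hy hz; rewrite /close; lra.
have P_nonempty : exists s x y z, P s x y z.
  exists s1, a, b, h; split=> //.
  - by have := lD _ _ Dab; have := Dl _ _ Dab; rewrite /s1 /e; lra.
  - by exists 0; rewrite ?addr0.
  - exact: D_lim.
  - by move=> [/Dl + _]; rewrite /s1 /e; lra.
have [K PK] := P_bounded.
have [s0 [x1 [y1 [z1 [P1 Pmax]]]]] := compact_max4 PK P_closed P_nonempty.
have [|||_ [x [y [z [[-> Pz] Pzmax]]]]] := @compact_max4 R (fun c x y z => c = z /\ P s0 x y z) K.
- by move=> c x y z [-> /PK[]].
- suff : open4 (fun c x y z => (c <> z) \/ ~ P s0 x y z).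
    move=> oP c x y z nP; have [|f f0 fP] := oP c x y z; first by move/not_andP: nP.
    by exists f => // c' x' y' z' hc hx hy hz; apply/not_andP; exact: fP.
  apply: open4U; last exact: (@open4_slice (fun e x y z => ~ P e x y z)).
  move=> c x y z /eqP; rewrite neq_lt => /orP[cz|cz].
    by exists ((z - c) / 2) => [|c' x' y' z']; rewrite /close; lra.
  by exists ((c - z) / 2) => [|c' x' y' z']; rewrite /close; lra.
- by exists z1, x1, y1, z1.
have [Dxy tz] := PD _ _ _ _ Pz.
have [hs hz uxyz lxy nW] := Pz.
have tZ : t0 + e <= x + s0 - e.
  by have := lim_ge _ _ lxy; move: hs; rewrite /s1; lra.
(* On the mirror plane the image is the point itself lowered by [e], hence strictly under the graph.
   The translation serves this purpose: contacts are off the mirror. *)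
have {}hz : x + s0 < z.
  rewrite lt_neqAle hz andbT; apply/eqP => zE; apply: nW; split.
    by rewrite -zE (_ : x + s0 - s0 = x) //; ring.
  split; first by lra.
  case: uxyz => t tt Gt; exists (t + e); first by lra.
  rewrite (_ : z - s0 = x); last by lra.
  by rewrite (_ : x + s0 - e + (t + e) = z + t) //; lra.
have [d1 d10 dD] := oD _ _ Dxy.
have [g [g0 gd ge gz]] : exists g, [/\ 0 < g, g <= d1, g <= e & 4 * g <= z - (x + s0)].
  exists (Num.min d1 (Num.min e ((z - (x + s0)) / 4))).
  rewrite !lt_min !ge_min d10 e0 !lexx /= orbT; split=> //.
    by rewrite divr_gt0 // subr_gt0.
  by rewrite mulrC -ler_pdivlMr ?ge_min ?lexx ?orbT.
have P_near s x' y' z' : close g x x' -> close g y y' -> close g z z' ->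
    s0 <= s < s0 + g -> under x' y' z' -> ~ W (z' - s) y' (x' + s - e) -> P s x' y' z'.
  rewrite /close => hx hy hz' hss u nW'; split=> //; [lra|lra|].
  by apply: D_lim; apply: dD; lra.
apply: (@glide_contact D t0 s0 e g x y z) => //.
- by lra.
- move=> [DXY bl]; apply: nW; split=> //; split; first by lra.
  by rewrite -addrA.
- move=> x' y' z' t hx hy hz' u /andP[t0' tg].
  suff [? [_ /below_under]] : W (z' - (s0 + t)) y' (x' + (s0 + t) - e) by [].
  apply: contrapT => nW'; have /Pmax : P (s0 + t) x' y' z'.
    by apply: P_near => //; rewrite lerDl ltrD2l (ltW t0').
  by rewrite leNgt ltrDl t0'.
- move=> x' y' z' hx hy hz' Gx G'; apply: (Pzmax _ x' y' z'); split=> //.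
  apply: P_near => //; first by rewrite lexx ltrDl.
    by exists 0; rewrite ?addr0.
  by move=> [_ [_]]; rewrite -addrA => /(not_below_G G').
Qed.

Lemma graph_height x y z : G x y z -> z <= 4 * r.
Proof.
move=> Gxyz; rewrite leNgt; apply/negP => hz; have r0 := r_gt0.
(* Half of the excess over [4 * r] is used: [t0] exceeds [2 * r], and [t0 + 2 * r] is still below
   [z]. *)
pose t0 := 2 * r + (z - 4 * r) / 2.
have Exy : above t0 x y by exists z => //; rewrite /t0; lra.
suff : z <= t0 + 2 * r by rewrite /t0; lra.
apply: height_above Gxyz _; [by rewrite /t0; lra..|].
move=> x1 y1 x2 y2 st1 st2.
apply: (@width_above t0 x1 y1 x2 y2); first by rewrite /t0; lra.
  exact: staircase_end st1.
exact: staircase_trans (staircase_sym st1) st2.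
Qed.

End Core.

(** * Immersions and vertical graphs *)

Lemma entry_le_norm (R : realType) m n (A : 'M[R]_(m, n)) i j : `|A i j| <= `|A|.
Proof. by rewrite [leRHS]mx_normrE; exact: (le_bigmax _ _ (i, j)). Qed.

Lemma norm_le_entry (R : realType) m n (A : 'M[R]_(m, n)) (e : R) :
  0 <= e -> (forall i j, `|A i j| <= e) -> `|A| <= e.
Proof.
by move=> e0 Ae; rewrite [leLHS]mx_normrE; apply: bigmax_le => // -[i j] _; exact: Ae.
Qed.

Lemma norm_mulmx_le (R : realType) m n p (A : 'M[R]_(m, n)) (B : 'M[R]_(n, p)) :
  `|A *m B| <= n%:R * `|A| * `|B|.
Proof.
apply: norm_le_entry => [|i j]; first by rewrite !mulr_ge0.
rewrite mxE (le_trans (ler_norm_sum _ _ _)) //.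
rewrite (le_trans (ler_sum _ (G := fun=> `|A| * `|B|) _)) //.
  by move=> k _; rewrite normrM ler_pM ?entry_le_norm.
by rewrite sumr_const card_ord -[leLHS]mulr_natl mulrA.
Qed.

Lemma is_derive_line (R : realType) (V W : normedModType R) (F : V -> W)
    (a v : V) (t : R) (d : W) :
  is_derive (a + t *: v) v F d -> is_derive t 1 (fun s : R => F (a + s *: v)) d.
Proof.
case=> dF dE.
have eqF : (fun h : R => h^-1 *: (F (a + (h *: 1 + t) *: v) - F (a + t *: v))) =
    (fun h => h^-1 *: (F (h *: v + (a + t *: v)) - F (a + t *: v))).
  apply/funext => h; congr (_ *: (F _ - _)).
  by rewrite scalerDl [h *: 1]mulr1 addrCA.
by split; [rewrite /derivable /= eqF|rewrite /derive /= eqF].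
Qed.

(** The mean value theorem on each coordinate along the segment from [a] to [b], on which the m
    partial derivatives stay within [e'] of their values at 0. Both ends vary, as injectivity and
    surjectivity estimates require. *)
Lemma strict_differentiability (R : realType) m n (F : 'rV[R]_m -> 'rV[R]_n) :
  (\forall a \near (0 : 'rV[R]_m), differentiable F a) ->
  (forall v, {for 0, continuous ('D_v F)}) ->
  forall e, 0 < e -> exists2 d, 0 < d & forall a b, `|a| < d -> `|b| < d ->
    `|F b - F a - 'D_(b - a) F 0| <= e * `|b - a|.
Proof.
move=> dF cF e e0; pose e' := e / (m%:R + 1).
have m1 : (0 : R) < m%:R + 1 by rewrite ltr_wpDl.
have e'0 : 0 < e' by rewrite divr_gt0.
have pF : \forall a \near (0 : 'rV[R]_m),
    forall i, `|'D_(delta_mx 0 i) F 0 - 'D_(delta_mx 0 i) F a| < e'.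
  apply: (@filter_forall _ _ (fun i a => `|'D_(delta_mx 0 i) F 0 - 'D_(delta_mx 0 i) F a| < e') (nbhs (0 : 'rV[R]_m))) => i.
  by have /cvgrPdist_lt/(_ _ e'0) := cF (delta_mx 0 i).
have : \forall a \near (0 : 'rV[R]_m), differentiable F a /\
    forall i, `|'D_(delta_mx 0 i) F 0 - 'D_(delta_mx 0 i) F a| < e'.
  by apply: filterS2 dF pF => a ? ?; split.
move=> /nbhs_normP[d /= d0 dP]; exists d => // a b ad bd.
have line (t : R) : 0 <= t <= 1 -> `|a + t *: (b - a)| < d.
  move=> /andP[t0 t1]; have -> : a + t *: (b - a) = (1 - t) *: a + t *: b.
    by rewrite scalerBr scalerBl scale1r -addrA [- _ + _]addrC.
  rewrite (le_lt_trans (ler_normD _ _)) // !normrZ.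
  have : Num.max `|a| `|b| < d by rewrite gt_max ad.
  have : `|a| <= Num.max `|a| `|b| by rewrite le_max lexx.
  have : `|b| <= Num.max `|a| `|b| by rewrite le_max lexx orbT.
  by rewrite ger0_norm ?subr_ge0 // ger0_norm //; nra.
have {}dP (t : R) : 0 <= t <= 1 -> differentiable F (a + t *: (b - a)) /\
    forall i, `|'D_(delta_mx 0 i) F 0 - 'D_(delta_mx 0 i) F (a + t *: (b - a))| < e'.
  by move=> /line td; apply: dP; rewrite /ball_ /= sub0r normrN.
have d00 : differentiable F 0 := nbhs_singleton dF.
apply: norm_le_entry => [|i k]; first by rewrite mulr_ge0 // ltW.
rewrite (ord1 i) !mxE {i}.
pose g (t : R) := F (a + t *: (b - a)) 0 k.
pose dg (t : R) := 'D_(b - a) F (a + t *: (b - a)) 0 k.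
have gd (t : R) : 0 <= t <= 1 -> is_derive t 1 g (dg t).
  move=> /dP[dFt _]; apply: (@is_derive_line _ _ _ (fun x => F x 0 k)).
  have dv : derivable F (a + t *: (b - a)) (b - a) by exact: diff_derivable.
  split; first by move/derivable_mxP : dv; apply.
  by rewrite /dg derive_mx // mxE.
have [t| |c cin] := @MVT R g dg 0 1 ltr01.
- by rewrite in_itv /= => /andP[? ?]; apply: gd; rewrite !ltW.
- apply: continuous_in_subspaceT => t /set_mem /=; rewrite in_itv /= => /gd[+ _].
  by move/derivable1_diffP/differentiable_continuous.
rewrite /g subr0 mulr1 scale1r scale0r addr0 addrCA subrr addr0 => ->.
have {cin} /dP[dFc cc] : 0 <= c <= 1 by move: cin; rewrite in_itv /=; lra.
set x := a + c *: (b - a) in dFc cc *.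
rewrite (_ : _ - _ = ((b - a) *m (jacobian F x - jacobian F 0)) 0 k); last first.
  by rewrite /dg !deriveEjacobian // mulmxBr [in RHS]mxE [in X in _ = _ + X]mxE.
rewrite mxE (le_trans (ler_norm_sum _ _ _)) //.
rewrite (le_trans (ler_sum _ (G := fun=> `|b - a| * e') _)) //.
  move=> i _; rewrite normrM ler_pM ?entry_le_norm //.
  have jE y : differentiable F y -> jacobian F y i k = ('D_(delta_mx 0 i) F y) 0 k.
    by move=> dFy; rewrite deriveEjacobian // -rowE [RHS]mxE.
  have -> : (jacobian F x - jacobian F 0) i k = jacobian F x i k - jacobian F 0 i k.
    by rewrite [LHS]mxE [X in _ + X]mxE.
  move: (jE x dFc) (jE 0 d00) (ltW (cc i)).
  move: ('D_(delta_mx 0 i) F 0) ('D_(delta_mx 0 i) F x) => u v Jx J0; apply: le_trans.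
  rewrite (_ : _ - _ = v 0 k - u 0 k); last by congr (_ - _); [exact: Jx|exact: J0].
  rewrite distrC; have := entry_le_norm (u - v) 0 k.
  by rewrite [X in `|X| <= _]mxE [X in _ + X]mxE.
rewrite sumr_const card_ord -[leLHS]mulr_natl mulrCA [leRHS]mulrC ler_wpM2l //.
by rewrite /e' mulrA ler_pdivrMr // [e * _]mulrC ler_pM2r // lerDl.
Qed.

Lemma dotE (R : realType) n (v w : 'rV[R]_n) : dot v w = (v *m w^T) 0 0.
Proof. by rewrite mxE; apply: eq_bigr => i _; rewrite mxE. Qed.

Lemma dotC (R : realType) n (v w : 'rV[R]_n) : dot v w = dot w v.
Proof. by apply: eq_bigr => i _; rewrite mulrC. Qed.

Lemma dotDl (R : realType) n (u v w : 'rV[R]_n) : dot (u + v) w = dot u w + dot v w.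
Proof. by rewrite !dotE mulmxDl mxE. Qed.

Lemma dotNl (R : realType) n (v w : 'rV[R]_n) : dot (- v) w = - dot v w.
Proof. by rewrite !dotE mulNmx mxE. Qed.

Lemma dotBl (R : realType) n (u v w : 'rV[R]_n) : dot (u - v) w = dot u w - dot v w.
Proof. by rewrite dotDl dotNl. Qed.

Lemma dotZl (R : realType) n (t : R) (v w : 'rV[R]_n) : dot (t *: v) w = t * dot v w.
Proof. by rewrite !dotE -scalemxAl mxE. Qed.

Lemma dotDr (R : realType) n (u v w : 'rV[R]_n) : dot u (v + w) = dot u v + dot u w.
Proof. by rewrite dotC dotDl !(dotC u). Qed.

Lemma dotNr (R : realType) n (u v : 'rV[R]_n) : dot u (- v) = - dot u v.
Proof. by rewrite dotC dotNl dotC. Qed.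

Lemma dotBr (R : realType) n (u v w : 'rV[R]_n) : dot u (v - w) = dot u v - dot u w.
Proof. by rewrite dotDr dotNr. Qed.

Lemma dotZr (R : realType) n (t : R) (v w : 'rV[R]_n) : dot v (t *: w) = t * dot v w.
Proof. by rewrite dotC dotZl dotC. Qed.

Lemma dot0l (R : realType) n (v : 'rV[R]_n) : dot 0 v = 0.
Proof. by rewrite dotE mul0mx mxE. Qed.

Lemma dot_ge0 (R : realType) n (v : 'rV[R]_n) : 0 <= dot v v.
Proof. by apply: sumr_ge0 => i _; rewrite -expr2 sqr_ge0. Qed.

Lemma dot_eq0 (R : realType) n (v : 'rV[R]_n) : dot v v = 0 -> v = 0.
Proof.
move=> /eqP; rewrite psumr_eq0 => [/allP v0|i _]; last by rewrite -expr2 sqr_ge0.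
apply/rowP => i; apply/eqP; rewrite mxE -sqrf_eq0 expr2.
by apply: v0; rewrite mem_index_enum.
Qed.

Lemma enorm_sqr (R : realType) n (v : 'rV[R]_n) : enorm v ^+ 2 = dot v v.
Proof. by rewrite sqr_sqrtr ?dot_ge0. Qed.

Lemma enorm_ge0 (R : realType) n (v : 'rV[R]_n) : 0 <= enorm v.
Proof. exact: sqrtr_ge0. Qed.

Lemma norm_le_enorm (R : realType) n (v : 'rV[R]_n) : `|v| <= enorm v.
Proof.
apply: norm_le_entry => [|i j]; first exact: enorm_ge0.
rewrite (ord1 i) -ler_sqr ?nnegrE ?enorm_ge0 // real_normK ?num_real //.
rewrite enorm_sqr /dot (bigD1 j) //= -expr2 lerDl sumr_ge0 // => k _.
by rewrite -expr2 sqr_ge0.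
Qed.

Lemma dot_le_norm (R : realType) (v w : 'rV[R]_3) : `|dot v w| <= 3 * `|v| * `|w|.
Proof.
rewrite (le_trans (ler_norm_sum _ _ _)) //.
rewrite (le_trans (ler_sum _ (G := fun=> `|v| * `|w|) _)) //.
  by move=> i _; rewrite normrM ler_pM ?entry_le_norm.
by rewrite sumr_const card_ord -[leLHS]mulr_natl mulrA.
Qed.

Lemma lipschitz_within (R : realType) (V W : normedModType R) (f : V -> W)
    (A : set V) (k : R) :
  (forall a b, A a -> A b -> `|f a - f b| <= k * `|a - b|) ->
  {within A, continuous f}.
Proof.
move=> fk; apply/subspace_continuousP => a Aa; apply/cvgrPdist_lt => e e0.
have k0 : 0 < `|k| + 1 by rewrite ltr_wpDl.
rewrite near_withinE; apply/nbhs_normP; exists (e / (`|k| + 1)); first by rewrite /= divr_gt0.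
move=> b; rewrite /ball_ /= ltr_pdivlMr // => ab Ab.
rewrite (le_lt_trans (fk _ _ Aa Ab)) // (le_lt_trans _ ab) // mulrC ler_wpM2l //.
by rewrite (le_trans (ler_norm k)) // lerDl.
Qed.

(** * Immersions of the plane near a point, with a unit normal *)

Section Immersion.
Variables (R : realType) (F : 'rV[R]_2 -> 'rV[R]_3) (N : 'rV[R]_3).
Hypothesis F_diff : \forall a \near (0 : 'rV[R]_2), differentiable F a.
Hypothesis dF_continuous : forall v, {for 0, continuous ('D_v F)}.
Hypothesis F_immersion : forall v, 'D_v F 0 = 0 -> v = 0.
Hypothesis N_unit : dot N N = 1.
Hypothesis N_normal : forall v, dot ('D_v F 0) N = 0.

(** The images of the basis vectors and [N] form a basis of space; [A] and [c] are the blocks of the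
    inverse matrix, that is, the tangential and normal coordinates. *)
Lemma immersion_left_inverse :
  exists (A : 'M[R]_(3, 2)) (c : 'M[R]_(3, 1)),
    [/\ forall v, 'D_v F 0 *m A = v, N *m A = 0 &
        forall u, u = 'D_(u *m A) F 0 + (u *m c) 0 0 *: N].
Proof.
have d0 : differentiable F 0 := nbhs_singleton F_diff.
have DJ v : 'D_v F 0 = v *m jacobian F 0 by rewrite deriveEjacobian.
move: (jacobian F 0) DJ => J DJ.
pose M : 'M[R]_(2 + 1) := col_mx J N.
have : M \in unitmx.
  rewrite -row_free_unit -kermx_eq0; apply/eqP/row_matrixP => i.
  rewrite row0; have : row i (kermx M) *m M = 0 by rewrite -row_mul mulmx_ker row0.
  move: (row i _) => u; rewrite -[u]hsubmxK mul_row_col => uM.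
  have u2 : (rsubmx u) *m N = (rsubmx u) 0 0 *: N.
    by rewrite [rsubmx u in LHS]mx11_scalar mul_scalar_mx.
  have u20 : (rsubmx u) 0 0 = 0.
    have : dot (lsubmx u *m J + rsubmx u *m N) N = 0 by rewrite uM dot0l.
    by rewrite dotDl -DJ N_normal add0r u2 dotZl N_unit mulr1.
  have : lsubmx u = 0 by apply: F_immersion; rewrite DJ -[RHS]uM u2 u20 scale0r addr0.
  by rewrite [rsubmx u]mx11_scalar u20 => ->; rewrite raddf0 row_mx0.
move=> MU; have MV := mulmxV MU; have VM := mulVmx MU.
rewrite scalar_mx_block in MV.
move: MV VM; rewrite -[invmx M]hsubmxK mul_col_row mul_row_col.
move: (lsubmx _) (rsubmx _) => A c /eq_block_mx[JA _ NA _] AJcN.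
exists A, c; split=> // [v|u]; first by rewrite DJ -mulmxA JA mulmx1.
transitivity (u *m (A *m J + c *m N)); first by rewrite AJcN mulmx1.
rewrite mulmxDr DJ !mulmxA; congr (_ + _).
by rewrite [u *m c in LHS]mx11_scalar mul_scalar_mx.
Qed.

(** Read in the coordinates [A], the map [F] differs from the identity by a map of Lipschitz
    constant 1/2. The same estimate drives the surjectivity below. *)
Lemma immersion_locally_injective : exists (A : 'M[R]_(3, 2)) (d : R), [/\ 0 < d,
  forall a b, `|a| < d -> `|b| < d -> `|(F b - F a) *m A - (b - a)| <= `|b - a| / 2 &
  (forall v, 'D_v F 0 *m A = v) /\ exists c : 'M[R]_(3, 1),
     forall u, u = 'D_(u *m A) F 0 + (u *m c) 0 0 *: N].
Proof.
have [A [c [DA NA Ac]]] := immersion_left_inverse.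
pose e := (2 * (3 * (`|A| + 1)))^-1.
have A1 : 0 < `|A| + 1 by rewrite ltr_wpDl.
have e0 : 0 < e by rewrite invr_gt0 !mulr_gt0.
have [d d0 dF] := strict_differentiability F_diff dF_continuous e0.
exists A, d; split=> // [a b ad bd|]; last by split=> //; exists c.
rewrite -[X in _ - X](DA (b - a)) -mulmxBl (le_trans (norm_mulmx_le _ _)) //.
have := dF a b ad bd; set x := `|_ - 'D_ _ _ _| => xe.
rewrite ler_pdivlMr //.
have -> : `|b - a| = 3 * (e * `|b - a|) * (`|A| + 1) * 2.
  by rewrite /e; field; rewrite gt_eqF.
rewrite ler_pM2r //; have x0 : 0 <= x by exact: normr_ge0.
apply: ler_pM; [by rewrite mulr_ge0|by []|by rewrite ler_pM2l|by rewrite lerDl].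
Qed.

(** Strict differentiability bounds the normal part of a chord by the distance of the parameters,
    which the injectivity estimate bounds by the chord itself. The result concerns image points
    only. *)
Lemma immersion_tangent_bound e : 0 < e -> exists2 d, 0 < d & forall a b,
  `|a| < d -> `|b| < d -> `|dot (F b - F a) N| <= e * `|F b - F a|.
Proof.
move=> e0; have [A [d1 [d10 inj _]]] := immersion_locally_injective.
have N1 : 0 < `|N| + 1 by rewrite ltr_wpDl.
have A1 : 0 < `|A| + 1 by rewrite ltr_wpDl.
pose e' := e / (18 * (`|N| + 1) * (`|A| + 1)).
have e'0 : 0 < e' by rewrite divr_gt0 // !mulr_gt0.
have [d2 d20 dF] := strict_differentiability F_diff dF_continuous e'0.
exists (Num.min d1 d2) => [|a b]; first by rewrite lt_min d10.
rewrite !lt_min => /andP[ad1 ad2] /andP[bd1 bd2].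
have ab : `|b - a| <= 6 * (`|A| + 1) * `|F b - F a|.
  have := inj a b ad1 bd1; have := norm_mulmx_le (F b - F a) A.
  have := ler_normB ((F b - F a) *m A) ((F b - F a) *m A - (b - a)).
  rewrite opprB addrC subrK; have := normr_ge0 (F b - F a); have := normr_ge0 A.
  by move=> *; nra.
have -> : dot (F b - F a) N = dot (F b - F a - 'D_(b - a) F 0) N.
  by rewrite [RHS]dotBl N_normal subr0.
rewrite (le_trans (dot_le_norm _ _)) //.
have := dF a b ad2 bd2; set x := `|_ - 'D_ _ _ _| => xe.
have -> : e = 3 * (e' * (6 * (`|A| + 1))) * (`|N| + 1).
  by rewrite /e'; field; rewrite !gt_eqF.
have x0 : 0 <= x by exact: normr_ge0.
have xy : x <= e' * (6 * (`|A| + 1)) * `|F b - F a|.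
  by apply: le_trans xe _; rewrite -[leRHS]mulrA ler_pM2l.
have n0 := normr_ge0 N; have xN : 3 * x * `|N| <=
    3 * (e' * (6 * (`|A| + 1)) * `|F b - F a|) * (`|N| + 1).
  by move: (e' * _ * _) xy => K xK; nra.
by rewrite (le_trans xN) // le_eqVlt; apply/orP; left; apply/eqP; ring.
Qed.

(** The tangential distance [h a] from [F a] to [Z] attains a minimum on a compact ball. The minimum
    is 0, since a Newton-like step would lower a positive one; the remaining difference is then a
    multiple of [N]. *)
Lemma immersion_locally_surjective e : 0 < e -> exists2 d, 0 < d &
  forall Z, `|Z - F 0| < d -> exists (a : 'rV[R]_2) (t : R),
    [/\ `|a| < e, `|t| < e & Z + t *: N = F a].
Proof.
have [A [d1 [d10 inj [DA [c Ac]]]]] := immersion_locally_injective.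
have D0 : 'D_(0 : 'rV[R]_2) F 0 = 0.
  by rewrite deriveE ?linear0 //; exact: nbhs_singleton F_diff.
move=> e0; have cF : {for 0, continuous F}.
  by apply: differentiable_continuous; exact: nbhs_singleton F_diff.
have e6 : 0 < e / 6 by rewrite divr_gt0.
have /cvgrPdist_lt/(_ _ e6)/nbhs_normP[f /= f0 Ff] := cF.
pose r := Num.min (Num.min e f) d1 / 2.
have [r0 re rf rd] : [/\ 0 < r, r < e, r < f & r < d1].
  have m0 : 0 < Num.min (Num.min e f) d1 by rewrite !lt_min e0 f0.
  have : Num.min (Num.min e f) d1 <= e by rewrite !ge_min lexx.
  have : Num.min (Num.min e f) d1 <= f by rewrite !ge_min lexx orbT.
  have : Num.min (Num.min e f) d1 <= d1 by rewrite ge_min lexx orbT.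
  by rewrite /r => *; split; lra.
pose B := [set a : 'rV[R]_2 | `|a| <= r].
have cB : compact B.
  apply: bounded_closed_compact.
    by exists r; split=> [|x rx a /le_trans]; [exact: num_real|apply; exact: ltW].
  by apply: (@closed_comp _ _ (fun a : 'rV[R]_2 => `|a|) [set x | x <= r]); [move=> ? _; exact: norm_continuous|exact: closed_le].
pose k := 12 * (`|A| + 1).
have A1 : 0 < `|A| + 1 by rewrite ltr_wpDl.
have k0 : 0 < k by rewrite mulr_gt0.
exists (Num.min (e / 6) (r / k)) => [|Z]; first by rewrite lt_min e6 divr_gt0.
rewrite lt_min [X in _ && X]ltr_pdivlMr // => /andP[Ze Zk].
pose h a := `|(F a - Z) *m A|.
have hlip a b : B a -> B b -> `|h a - h b| <= 2 * `|a - b|.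
  rewrite /B /= => aB bB; rewrite (le_trans (ler_dist_dist _ _)) //.
  rewrite -mulmxBl opprB addrA subrK; have := inj b a (le_lt_trans bB rd) (le_lt_trans aB rd).
  have := ler_normD ((F a - F b) *m A - (a - b)) (a - b); rewrite subrK.
  have := normr_ge0 (a - b); move=> *; lra.
have [|a /set_mem aB amin] := compact_EVT_min _ cB (lipschitz_within hlip).
  by exists 0; rewrite /B /= normr0 ltW.
(* This keeps the minimizer off the boundary of the ball: half the norm of [a] is at most
   [h a + h 0 <= 2 * h 0 < r / 2]. *)
have h0 : h 0 < r / 4.
  rewrite /h (le_lt_trans (norm_mulmx_le _ _)) // distrC.
  move: (normr_ge0 (Z - F 0)) (normr_ge0 A) Zk; rewrite /k.
  move: (`|Z - F 0|) (`|A|) => z y.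
  move=> *; nra.
have ha0 : h a <= h 0 by apply: amin; rewrite inE /B /= normr0 ltW.
have ar : `|a| < r.
  have := inj 0 a; rewrite normr0 d10 subr0 => /(_ isT (le_lt_trans aB rd)).
  have := ler_normB ((F a - F 0) *m A) ((F a - F 0) *m A - a).
  rewrite opprB addrC subrK; have := ler_normB ((F a - Z) *m A) ((F 0 - Z) *m A).
  rewrite -mulmxBl opprB addrA subrK; rewrite -/(h a) -/(h 0); move=> *; lra.
have FaZ : (F a - Z) *m A = 0.
  apply/eqP; rewrite -normr_eq0 eq_le normr_ge0 andbT -/(h a) leNgt; apply/negP => ha.
  pose v := (F a - Z) *m A.
  (* The step [- t *: v] stays in the ball and, by the estimate with constant 1/2, brings the value
     down to at most [(1 - t / 2) * h a]. *)
  pose t := Num.min 1 ((r - `|a|) / h a).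
  have t0 : 0 < t by rewrite lt_min ltr01 divr_gt0 // subr_gt0.
  have t1 : t <= 1 by rewrite ge_min lexx.
  have tv : `|t *: v| <= r - `|a|.
    by rewrite normrZ gtr0_norm // -ler_pdivlMr // ge_min lexx orbT.
  have bB : B (a - t *: v).
    by rewrite /B /= (le_trans (ler_normB _ _)) //; lra.
  have := inj a (a - t *: v) (lt_trans ar rd) (le_lt_trans bB rd).
  have := amin (a - t *: v); rewrite inE => /(_ bB).
  rewrite [_ - _ - a]addrAC subrr add0r opprK normrN.
  have -> : (F (a - t *: v) - F a) *m A + t *: v = (F (a - t *: v) - Z) *m A - (1 - t) *: v.
    rewrite scalerBl scale1r opprB addrCA [LHS]addrC; congr (_ + _).
    by rewrite /v -mulmxBl opprB addrA subrK.
  have := ler_normD ((F (a - t *: v) - Z) *m A - (1 - t) *: v) ((1 - t) *: v).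
  rewrite subrK -/(h _) !normrZ [`|1 - t|]ger0_norm ?subr_ge0 // (gtr0_norm t0) -/(h a).
  by move: (h a) ha => x x0 *; nra.
have [s us] : exists s, F a - Z = s *: N.
  by exists (((F a - Z) *m c) 0 0); rewrite [LHS]Ac FaZ D0 add0r.
exists a, s; split; [exact: lt_trans ar re| |by rewrite -us addrC subrK].
have -> : s = dot (F a - Z) N by rewrite us dotZl N_unit mulr1.
rewrite (le_lt_trans (dot_le_norm _ _)) //.
have N1 : `|N| <= 1 by rewrite (le_trans (norm_le_enorm N)) // /enorm N_unit sqrtr1.
have x3 : `|F a - Z| < e / 3.
  have := Ff a; rewrite /ball_ /= sub0r normrN => /(_ (lt_trans ar rf)).
  have := ler_normD (F a - F 0) (F 0 - Z); rewrite addrA subrK [`|F a - F 0|]distrC.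
  by move: Ze; rewrite [`|Z - F 0|]distrC => *; lra.
by move: (normr_ge0 (F a - Z)) (normr_ge0 N) N1 x3; move: (`|F a - Z|) (`|N|) => *; nra.
Qed.

Lemma immersion_tangent_plane v : dot v N = 0 -> exists w, v = 'D_w F 0.
Proof.
have [A [c [DA NA Ac]]] := immersion_left_inverse => vN; exists (v *m A).
have := congr1 (fun u => dot u N) (Ac v); rewrite dotDl N_normal vN dotZl N_unit mulr1 add0r.
by move=> c0; rewrite [LHS]Ac -c0 scale0r addr0.
Qed.

End Immersion.

Lemma lipschitz_IVT (R : realType) (f : R -> R) (a b v k : R) : a <= b ->
  (forall s t, a <= s <= b -> a <= t <= b -> `|f s - f t| <= k * `|s - t|) ->
  between (f a) (f b) v -> exists2 c, a <= c <= b & f c = v.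
Proof.
move=> ab fk fv; have [| |c] := @IVT R f a b v ab; last by rewrite in_itv; exists c.
  by apply: (@lipschitz_within R R R f `[a, b] k) => s t; rewrite /= !in_itv; exact: fk.
by move: fv; rewrite /between; case: (leP (f a) (f b)) => ? [] ?; lra.
Qed.

(** An injective continuous function vanishing at 0 changes sign there: with equal signs at both
    ends, some common value would be taken on both sides. *)
Lemma lipschitz_sign (R : realType) (f : R -> R) (r k : R) : 0 < r -> f 0 = 0 ->
  (forall s t, - r <= s <= r -> - r <= t <= r -> `|f s - f t| <= k * `|s - t|) ->
  (forall s t, - r <= s <= r -> - r <= t <= r -> f s = f t -> s = t) ->
  exists2 sigma : R, sigma = 1 \/ sigma = -1 &
    forall t, 0 < t <= r -> 0 < sigma * f t /\ sigma * f (- t) < 0.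
Proof.
move=> r0 f0 flip finj.
have fIVT a b v : a <= b -> - r <= a -> b <= r -> between (f a) (f b) v ->
    exists2 c, a <= c <= b & f c = v.
  move=> ab ar br; apply: (lipschitz_IVT (k := k)) => // s t /andP[? ?] /andP[? ?].
  by apply: flip; lra.
have f_neq0 t : - r <= t <= r -> f t = 0 -> t = 0.
  by move=> tr ft; apply: finj => //; [rewrite oppr_le0 (ltW r0)|rewrite ft f0].
have rr : - r <= r <= r /\ - r <= - r <= r by split; lra.
have fr : f r <> 0 by move=> /f_neq0 h; have := h rr.1; lra.
have fr' : f (- r) <> 0 by move=> /f_neq0 h; have := h rr.2; lra.
have same v : v <> 0 -> between 0 (f r) v -> between 0 (f (- r)) v -> False.
  move=> v0 b1 b2.
  have [||||c c1 fc] := @fIVT 0 r v; [exact: ltW|lra|exact: lexx|by rewrite f0|].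
  have [||||c' c1' fc'] := @fIVT (- r) 0 v;
    [lra|exact: lexx|exact: ltW|by rewrite f0; exact: between_sym|].
  have cc : c = c' by apply: finj; [lra|lra|rewrite fc fc'].
  have c0 : c = 0 by lra.
  by apply: v0; rewrite -fc c0.
have [sigma sigma1 [fr1 fr2]] : exists2 sigma : R, sigma = 1 \/ sigma = -1 &
    0 < sigma * f r /\ sigma * f (- r) < 0.
  move: (f r) (f (- r)) fr fr' same {fIVT} => x y x0 y0 same.
  have [x1|x1|//] := ltgtP x 0; have [y1|y1|//] := ltgtP y 0.
  - exfalso; apply: (same (Num.max x y)); rewrite /between; case: (leP x y) => ?; lra.
  - by exists (-1); [right|lra].
  - by exists 1; [left|lra].
  - exfalso; apply: (same (Num.min x y)); rewrite /between; case: (leP x y) => ?; lra.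
exists sigma => // t /andP[t0 tr]; rewrite !ltNge; split; apply/negP => ft.
- have [|||c /andP[ct cr] fc] := @fIVT t r 0 tr; [lra|exact: lexx| |].
    by rewrite /between; case: sigma1 ft fr1 => -> *; lra.
  have c0 : c = 0 by apply: f_neq0 => //; lra.
  by move: ct; rewrite c0; lra.
- have [||||c /andP[cr ct] fc] := @fIVT (- r) (- t) 0; [lra|exact: lexx|lra| |].
    by rewrite /between; case: sigma1 ft fr2 => -> *; lra.
  have c0 : c = 0 by apply: f_neq0 => //; lra.
  by move: ct; rewrite c0; lra.
Qed.

Lemma lipschitz_root (R : realType) (g : R -> R) (e k : R) : 0 < e ->
  (forall s t, - e <= s <= e -> - e <= t <= e -> `|g s - g t| <= k * `|s - t|) ->
  g (- e) < 0 -> 0 < g e ->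
  (g 0 < 0 -> exists2 t, 0 < t < e & g t = 0) /\
  (0 < g 0 -> exists2 t, - e < t < 0 & g t = 0).
Proof.
move=> e0 glip g1 g2; split=> g0.
- have [|||c /andP[c0 ce] gc] := @lipschitz_IVT R g 0 e 0 k; [exact: ltW| | |].
  + by move=> s t /andP[? ?] /andP[? ?]; apply: glip; lra.
  + by left; rewrite !ltW.
  exists c => //; rewrite !lt_neqAle c0 ce !andbT.
  apply/andP; split; apply/eqP => cE.
    by move: gc; rewrite -cE => ?; lra.
  by move: gc; rewrite cE => ?; lra.
- have [|||c /andP[ce c0] gc] := @lipschitz_IVT R g (- e) 0 0 k; [lra| | |].
  + by move=> s t /andP[? ?] /andP[? ?]; apply: glip; lra.
  + by left; rewrite !ltW.
  exists c => //; rewrite !lt_neqAle c0 ce !andbT.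
  apply/andP; split; apply/eqP => cE.
    by move: gc; rewrite -cE => ?; lra.
  by move: gc; rewrite cE => ?; lra.
Qed.

(** * Sides of a set that meets each vertical line at most once *)

Definition e3 (R : realType) : 'rV[R]_3 := vec3 0 0 1.

Lemma norm_e3 (R : realType) : `|e3 R| <= 1.
Proof.
apply: norm_le_entry => // i [[|[|[|//]]] ?]; rewrite mxE /=; by rewrite ?normr0 ?normr1.
Qed.

Definition hypograph (R : realType) (G : set 'rV[R]_3) : set 'rV[R]_3 :=
  [set Z | exists2 t, 0 <= t & G (Z + t *: e3 R)].

Definition strict_hypograph (R : realType) (G : set 'rV[R]_3) : set 'rV[R]_3 :=
  [set Z | exists2 t, 0 < t & G (Z + t *: e3 R)].

Definition strict_epigraph (R : realType) (G : set 'rV[R]_3) : set 'rV[R]_3 :=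
  [set Z | exists2 t, t < 0 & G (Z + t *: e3 R)].

Section Sides.
Variables (R : realType) (G : set 'rV[R]_3) (X N : 'rV[R]_3).
Hypothesis GX : G X.
Hypothesis G_graph : forall Y t, G Y -> G (Y + t *: e3 R) -> t = 0.
Hypothesis N_unit : dot N N = 1.
Hypothesis G_tangent : forall e, 0 < e -> exists2 d, 0 < d & forall Y Z,
  G Y -> G Z -> `|Y - X| < d -> `|Z - X| < d -> `|dot (Z - Y) N| <= e * `|Z - Y|.
Hypothesis G_cover : forall e, 0 < e -> exists2 d, 0 < d & forall Z,
  `|Z - X| < d -> exists2 t, `|t| < e & G (Z + t *: N).

Let norm_N : `|N| <= 1.
Proof. by rewrite (le_trans (norm_le_enorm N)) // /enorm N_unit sqrtr1. Qed.

(** Near [X] the set is a graph in the direction [N]. The height is defined at points of space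
    rather than of the tangent plane, so nothing has to be projected: sliding the base point along
    [N] just shifts [h]. *)
Lemma height_function : exists (h : 'rV[R]_3 -> R) (d r : R), [/\ 0 < d, 0 < r,
  forall Z, `|Z - X| < r -> G (Z + h Z *: N),
  forall Z t, `|Z - X| < r -> `|t| < d -> G (Z + t *: N) -> t = h Z &
  forall Y Z, `|Y - X| < r -> `|Z - X| < r -> `|h Z - h Y| <= 4 * `|Z - Y|].
Proof.
(* With 1/6, the difference of two heights is at most three times the distance D of the base points
   plus a sixth of D and of itself; this gives the constant 4. *)
have [d1 d10 tan] := G_tangent (e := 1 / 6) ltac:(by rewrite divr_gt0).
pose d := d1 / 2; have d0 : 0 < d by rewrite divr_gt0.
have [d2 d20 cov] := G_cover d0.
pose r := Num.min d2 d.
have r0 : 0 < r by rewrite lt_min d20.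
have rd : r <= d by rewrite ge_min lexx orbT.
have rd2 : r <= d2 by rewrite ge_min lexx.
have sd (Z : 'rV[R]_3) t : `|Z - X| < r -> `|t| < d -> `|Z + t *: N - X| < d1.
  move=> Zr td; rewrite addrAC (le_lt_trans (ler_normD _ _)) // normrZ.
  move: (normr_ge0 t) norm_N (normr_ge0 N) rd td; rewrite /d.
  by move: (`|t|) (`|N|) (`|Z - X|) Zr => *; nra.
have lip (Y Z : 'rV[R]_3) s t : `|Y - X| < r -> `|Z - X| < r -> `|s| < d -> `|t| < d ->
    G (Y + s *: N) -> G (Z + t *: N) -> `|t - s| <= 4 * `|Z - Y|.
  move=> Yd Zd s1 t1 Gs Gt; have := tan _ _ Gs Gt (sd _ _ Yd s1) (sd _ _ Zd t1).
  rewrite opprD addrACA -scalerBl dotDl dotZl N_unit mulr1.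
  have := dot_le_norm (Z - Y) N; have := ler_normD (Z - Y) ((t - s) *: N).
  rewrite normrZ; set u := dot _ _; set w := t - s.
  have := ler_normB (u + w) u; rewrite [u + w - u]addrAC subrr add0r.
  move: (normr_ge0 w) (normr_ge0 (Z - Y)) norm_N (normr_ge0 N).
  move: (`|w|) (`|Z - Y|) (`|N|) (`|u + w|) (`|u|) (`|_ + _|) => *; nra.
pose h Z := xget 0 [set t | `|t| < d /\ G (Z + t *: N)].
have hP Z : `|Z - X| < r -> `|h Z| < d /\ G (Z + h Z *: N).
  move=> Zr; have [|t td Gt] := cov Z; first exact: lt_le_trans rd2.
  by rewrite /h; apply: (@xgetPex _ 0 [set t | `|t| < d /\ G (Z + t *: N)]); exists t.
exists h, d, r; split=> // [Z /hP[]//|Z t Zr td Gt|Y Z Yr Zr].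
  have [hd Gh] := hP Z Zr; have := lip Z Z _ _ Zr Zr hd td Gh Gt.
  by rewrite subrr normr0 mulr0 normr_le0 subr_eq0 => /eqP.
have [hYd GhY] := hP Y Yr; have [hZd GhZ] := hP Z Zr.
exact: lip.
Qed.

Lemma height_sides (h : 'rV[R]_3 -> R) (d r : R) : 0 < d -> 0 < r ->
  (forall Z, `|Z - X| < r -> G (Z + h Z *: N)) ->
  (forall Z t, `|Z - X| < r -> `|t| < d -> G (Z + t *: N) -> t = h Z) ->
  (forall Y Z, `|Y - X| < r -> `|Z - X| < r -> `|h Z - h Y| <= 4 * `|Z - Y|) ->
  exists2 sigma : R, sigma = 1 \/ sigma = -1 & forall e, 0 < e ->
    exists2 u, 0 < u & forall Z, `|Z - X| < u ->
      [/\ sigma * h Z < 0 -> exists2 t, 0 < t < e & G (Z + t *: e3 R),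
          0 < sigma * h Z -> exists2 t, - e < t < 0 & G (Z + t *: e3 R) &
          sigma * h Z = 0 -> G Z].
Proof.
move=> d0 r0 hG huniq hlip.
have XX : `|X - X| < r by rewrite subrr normr0.
have hX : h X = 0.
  by apply/esym; apply: huniq => //; rewrite ?normr0 // scale0r addr0.
have Ge3 Y s t : G (Y + s *: e3 R) -> G (Y + t *: e3 R) -> s = t.
  move=> Gs Gt; apply/esym/eqP; rewrite -subr_eq0; apply/eqP; apply: G_graph Gs _.
  by rewrite -addrA -scalerDl addrCA subrr addr0.
have dist_e3 (Y : 'rV[R]_3) s t : `|Y + s *: e3 R - (Y + t *: e3 R)| <= `|s - t|.
  rewrite opprD addrACA subrr add0r -scalerBl normrZ.
  by rewrite -[leRHS]mulr1 ler_wpM2l // norm_e3.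
have shift (Z : 'rV[R]_3) t u : `|Z - X| <= u -> `|Z + t *: e3 R - X| <= u + `|t|.
  move=> Zu; rewrite addrAC (le_trans (ler_normD _ _)) // lerD // normrZ.
  by rewrite -[leRHS]mulr1 ler_wpM2l // norm_e3.
pose r1 := r / 2; have r10 : 0 < r1 by rewrite divr_gt0.
have line (Z : 'rV[R]_3) t : `|Z - X| < r1 -> - r1 <= t <= r1 -> `|Z + t *: e3 R - X| < r.
  rewrite -ler_norml => Zr tr; rewrite (le_lt_trans (shift _ _ _ (lexx _))) //.
  by move: Zr tr; rewrite /r1; lra.
have hline (Z : 'rV[R]_3) s t : `|Z - X| < r1 -> - r1 <= s <= r1 -> - r1 <= t <= r1 ->
    `|h (Z + s *: e3 R) - h (Z + t *: e3 R)| <= 4 * `|s - t|.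
  by move=> Zr sr tr; rewrite (le_trans (hlip _ _ _ _)) ?ler_pM2l ?line.
have XX1 : `|X - X| < r1 by rewrite subrr normr0.
have hsame s t : - r1 <= s <= r1 -> - r1 <= t <= r1 ->
    h (X + s *: e3 R) = h (X + t *: e3 R) -> s = t.
  move=> sr tr hst; apply: (@Ge3 (X + h (X + s *: e3 R) *: N)); rewrite addrAC.
    by apply: hG; exact: line.
  by rewrite hst; apply: hG; exact: line.
pose f t := h (X + t *: e3 R).
have f0 : f 0 = 0 by rewrite /f scale0r addr0.
have [sigma sigma1 fsign] := lipschitz_sign r10 f0 (fun s t => @hline X s t XX1) hsame.
have ss : sigma * sigma = 1 by case: sigma1 => ->; rewrite ?mulrNN mulr1.
have sn t : `|sigma * t| = `|t|.
  by rewrite normrM; case: sigma1 => ->; rewrite ?normrN normr1 mul1r.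
pose g Z := sigma * h Z.
have glip Y Z : `|Y - X| < r -> `|Z - X| < r -> `|g Z - g Y| <= 4 * `|Z - Y|.
  by rewrite /g -mulrBr sn; exact: hlip.
exists sigma => //; suff sides e : 0 < e <= r1 -> exists2 u, 0 < u <= r1 & forall Z, `|Z - X| < u ->
    [/\ g Z < 0 -> exists2 t, 0 < t < e & G (Z + t *: e3 R),
        0 < g Z -> exists2 t, - e < t < 0 & G (Z + t *: e3 R) & g Z = 0 -> G Z].
  move=> e e0; have [|u /andP[u0 _] sideu] := sides (Num.min e r1).
    by rewrite lt_min e0 r10 ge_min lexx orbT.
  have me : Num.min e r1 <= e by rewrite ge_min lexx.
  exists u => // Z /sideu[neg pos zero]; split=> // [/neg|/pos] [t tr Gt];
    by exists t => //; lra.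
move=> /andP[e0 er]; have [fe fe'] : 0 < sigma * f e /\ sigma * f (- e) < 0.
  by apply: fsign; rewrite e0.
(* On nearby vertical lines [sigma * h] deviates by less than [m] from its values through [X], so it
   keeps its signs at the heights [e] and [- e]. *)
pose m := Num.min (sigma * f e) (- (sigma * f (- e))).
have m0 : 0 < m by rewrite lt_min fe oppr_gt0.
have [me me'] : m <= sigma * f e /\ m <= - (sigma * f (- e)).
  by rewrite !ge_min !lexx orbT.
exists (Num.min r1 (m / 4)) => [|Z]; first by rewrite lt_min ge_min lexx r10 divr_gt0.
rewrite lt_min => /andP[Zr Zm].
have re : - r1 <= - e by rewrite lerN2.
have gshift t : - r1 <= t <= r1 -> `|g (Z + t *: e3 R) - sigma * f t| < m.
  move=> tr; rewrite (le_lt_trans (glip _ _ _ _)) ?line //.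
  by rewrite opprD addrACA subrr addr0 mulrC -ltr_pdivlMr.
have gG Y : `|Y - X| < r -> g Y = 0 -> G Y.
  move=> Yr gY; have := hG Y Yr; have -> : h Y = 0.
    by rewrite -[h Y]mul1r -ss -mulrA -/(g Y) gY mulr0.
  by rewrite scale0r addr0.
have line_e t : - e <= t <= e -> - r1 <= t <= r1.
  by move=> /andP[et te]; rewrite (le_trans re) // (le_trans te).
have ee : - e <= e <= e /\ - e <= - e <= e by rewrite !lexx andbT; split; rewrite ge0_cp ?ltW.
have g2 : 0 < g (Z + e *: e3 R).
  have := gshift e (line_e e ee.1); rewrite ltr_norml => /andP[+ _].
  by rewrite ltrBrDl; apply: le_lt_trans; rewrite subr_ge0.
have g1 : g (Z + (- e) *: e3 R) < 0.
  have := gshift _ (line_e _ ee.2); rewrite ltr_norml => /andP[_].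
  by rewrite ltrBlDr => /lt_le_trans; apply; rewrite -lerBrDr sub0r.
have [|neg pos] := lipschitz_root (g := fun t => g (Z + t *: e3 R)) (k := 4) e0 _ g1 g2.
  by move=> s t /line_e hs /line_e ht; rewrite /g -mulrBr sn; exact: hline.
rewrite scale0r addr0 in neg pos.
split=> [/neg[t te gt]|/pos[t te gt]|gZ]; last first.
- by apply: gG => //; apply: lt_trans Zr _; rewrite /r1 ltr_pdivrMr // ltr_pMr // ltr1n.
- exists t => //; apply: gG gt; apply: line => //; apply: line_e.
  by case/andP: te => /ltW -> /ltW/le_trans; apply; exact: ltW.
- exists t => //; apply: gG gt; apply: line => //; apply: line_e.
  by case/andP: te => t0 /ltW ->; rewrite andbT (le_trans _ (ltW t0)) // oppr_le0 ltW.
Qed.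

(** [sigma *: N] points under the set: a move by [t] along it lowers [sigma * h] by [t]. The clause
    on [hypograph] has one [d] for all [Z] near [X], as needed to compare with a second surface. *)
Lemma graph_sides : exists sigma : R, [/\ sigma = 1 \/ sigma = -1,
  forall e, 0 < e -> exists2 d, 0 < d & forall Z, `|Z - X| < d ->
    exists2 t, `|t| < e & G (Z + t *: e3 R),
  exists2 d, 0 < d & forall Z t, `|Z - X| < d -> hypograph G Z -> 0 < t < d ->
    strict_hypograph G (Z + t *: (sigma *: N)),
  forall v, 0 < dot v (sigma *: N) -> exists2 d, 0 < d & forall t, 0 < t < d ->
    strict_hypograph G (X + t *: v) &
  forall v, dot v (sigma *: N) < 0 -> exists2 d, 0 < d & forall t, 0 < t < d ->
    strict_epigraph G (X + t *: v)].
Proof.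
have [h [d [r [d0 r0 hG huniq hlip]]]] := height_function.
have [sigma sigma1 sides] := height_sides d0 r0 hG huniq hlip.
have XX : `|X - X| < r by rewrite subrr normr0.
have hX : h X = 0.
  by apply/esym; apply: huniq => //; rewrite ?normr0 // scale0r addr0.
have Ge3 Y s t : G (Y + s *: e3 R) -> G (Y + t *: e3 R) -> s = t.
  move=> Gs Gt; apply/esym/eqP; rewrite -subr_eq0; apply/eqP; apply: G_graph Gs _.
  by rewrite -addrA -scalerDl addrCA subrr addr0.
have ss : sigma * sigma = 1 by case: sigma1 => ->; lra.
have sn t : `|sigma * t| = `|t|.
  by rewrite normrM; case: sigma1 => ->; rewrite ?normrN normr1 mul1r.
pose g Z := sigma * h Z.
have [u [u0 ur side]] : exists u, [/\ 0 < u, u <= r & forall Z, `|Z - X| < u ->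
    [/\ g Z < 0 -> exists2 t, 0 < t & G (Z + t *: e3 R),
        0 < g Z -> exists2 t, t < 0 & G (Z + t *: e3 R) & g Z = 0 -> G Z]].
  have [u u0 side] := sides 1 ltr01.
  exists (Num.min u r); rewrite lt_min u0 ge_min lexx orbT; split=> // Z.
  rewrite lt_min => /andP[/side[neg pos zero] _].
  by split=> // [/neg|/pos] [t tr Gt]; exists t => //; lra.
have hyp_side (Z : 'rV[R]_3) : `|Z - X| < u -> g Z < 0 -> strict_hypograph G Z.
  by move=> /side[+ _ _] gZ => /(_ gZ).
have epi_side (Z : 'rV[R]_3) : `|Z - X| < u -> 0 < g Z -> strict_epigraph G Z.
  by move=> /side[_ + _] gZ => /(_ gZ).
have hle Z : `|Z - X| < r -> `|h Z| <= 4 * `|Z - X|.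
  by move=> Zr; have := hlip X Z XX Zr; rewrite hX subr0.
(* Chords being almost tangent, [sigma * h] at [X + t *: v] is [- t * dot v (sigma *: N)] up to half
   of this quantity. The chord is at most 5 = 1 + 4 times [t *: v], whence the 10 below. *)
have transversal v : dot v (sigma *: N) != 0 -> exists2 c, 0 < c & forall t, 0 < t < c ->
    `|X + t *: v - X| < u /\
    `|t * dot v (sigma *: N) + g (X + t *: v)| <= `|dot v (sigma *: N)| * t / 2.
  set s := dot v _ => s0; have v1 : 0 < `|v| + 1 by rewrite ltr_wpDl.
  have ns0 : 0 < `|s| by rewrite normr_gt0.
  have [|c c0 tan] := @G_tangent (`|s| / (10 * (`|v| + 1))); first by rewrite divr_gt0 ?mulr_gt0.
  exists (Num.min u c / (5 * (`|v| + 1))) => [|t].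
    by rewrite divr_gt0 ?mulr_gt0 // lt_min u0.
  rewrite ltr_pdivlMr ?mulr_gt0 // => /andP[t0].
  rewrite lt_min => /andP[tu tc].
  have tX : X + t *: v - X = t *: v by rewrite addrAC subrr add0r.
  have ntv : `|t *: v| = t * `|v| by rewrite normrZ gtr0_norm.
  have Xu : `|X + t *: v - X| < u.
    by rewrite tX ntv; move: (normr_ge0 v) tu => *; nra.
  have Xr : `|X + t *: v - X| < r by exact: lt_le_trans ur.
  split=> //; have hZ := hle _ Xr; rewrite tX ntv in hZ.
  have hN : `|h (X + t *: v) *: N| <= 4 * (t * `|v|).
    by rewrite normrZ; move: hZ norm_N (normr_ge0 N) (normr_ge0 (h (X + t *: v))) => *; nra.
  have := tan X _ GX (hG _ Xr); rewrite subrr normr0 => /(_ c0).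
  have -> : X + t *: v + h (X + t *: v) *: N - X = t *: v + h (X + t *: v) *: N.
    by rewrite addrAC; congr (_ + _); rewrite addrAC subrr add0r.
  have nle : `|t *: v + h (X + t *: v) *: N| <= 5 * (t * `|v|).
    by rewrite (le_trans (ler_normD _ _)) // ntv; move: hN => *; lra.
  have nc : `|t *: v + h (X + t *: v) *: N| < c.
    by move: nle tc (normr_ge0 v) => *; nra.
  move=> /(_ nc); rewrite dotDl !dotZl N_unit mulr1 -(sn (_ + _)) mulrDr.
  rewrite -/(g _) mulrCA -dotZr -/s => /le_trans; apply.
  have e'0 : 0 <= `|s| / (10 * (`|v| + 1)) by rewrite divr_ge0 // mulr_ge0 // ltW.
  apply: le_trans (ler_wpM2l e'0 nle) _.
  rewrite -[leLHS]mulrA -[leRHS]mulrA ler_pM2l // mulrC ler_pdivrMr ?mulr_gt0 //.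
  by move: (normr_ge0 v) t0; move: (`|v|) => y *; nra.
exists sigma; split=> //.
- move=> e e0; have [w w0 sidew] := sides e e0.
  exists w => // Z /sidew[neg pos zero]; have [/neg|/pos|/zero GZ] := ltgtP (g Z) 0.
  + by move=> [t tr Gt]; exists t => //; rewrite ltr_norml; lra.
  + by move=> [t tr Gt]; exists t => //; rewrite ltr_norml; lra.
  + by exists 0; rewrite ?normr0 // scale0r addr0.
- exists (Num.min (u / 2) (d / 5)) => [|Z t]; first by rewrite lt_min !divr_gt0.
  rewrite !lt_min => /andP[Zu Zd] [t1 t10 Gt1] /andP[t0 /andP[tu td]].
  have Zu' : `|Z - X| < u by lra.
  have Zr : `|Z - X| < r by exact: lt_le_trans ur.
  have gZ : g Z <= 0.
    rewrite leNgt; apply/negP => gZ; have [t2 t20 Gt2] := epi_side Z Zu' gZ.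
    by have := Ge3 _ _ _ Gt1 Gt2; lra.
  have nt : `|t *: (sigma *: N)| <= t.
    by rewrite !normrZ gtr0_norm // -[leRHS]mulr1 ler_wpM2l ?(ltW t0) // -[`|_| * _]normrZ; case: sigma1 => ->; rewrite ?scaleN1r ?normrN ?scale1r.
  have Z'u : `|Z + t *: (sigma *: N) - X| < u.
    by rewrite addrAC (le_lt_trans (ler_normD _ _)) //; lra.
  apply: hyp_side => //; rewrite /g; suff <- : h Z - t * sigma = h (Z + t *: (sigma *: N)).
    by rewrite mulrBr mulrCA ss mulr1 -/(g Z); lra.
  apply: huniq.
  - exact: lt_le_trans ur.
  - rewrite (le_lt_trans (ler_normB _ _)) // [t * _]mulrC sn (gtr0_norm t0).
    by have hZ4 := hle Z Zr; lra.
  - by rewrite scalerA -addrA -scalerDl addrCA subrr addr0; apply: hG.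
- move=> v s0; have [|c c0 cP] := transversal v; first by rewrite gt_eqF.
  exists c => // t tc; have [Xu] := cP t tc; rewrite ler_norml gtr0_norm // => sg.
  by apply: hyp_side => //; move: sg tc; move: (dot _ _) s0 (g _) => s s0 y *; nra.
- move=> v s0; have [|c c0 cP] := transversal v; first by rewrite lt_eqF.
  exists c => // t tc; have [Xu] := cP t tc; rewrite ler_norml ltr0_norm // => sg.
  by apply: epi_side => //; move: sg tc; move: (dot _ _) s0 (g _) => s s0 y *; nra.
Qed.

End Sides.

(** * Derivatives of germs, and smoothness under affine maps *)

Lemma diff_near_0 (R : numFieldType) (V W : normedModType R) (H : V -> W) (x : V) :
  (\forall z \near x, H z = 0) -> differentiable H x /\ forall v, 'D_v H x = 0.
Proof.
move=> H0; have Hx : H x = 0 := nbhs_singleton H0.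
have HE : H \o shift x = cst (H x) + \0 +o_ 0 id.
  apply/eqaddoP => e e0; have /nbhs_normP[d /= d0 Hd] := H0.
  apply/nbhs_normP; exists d => // h; rewrite /ball_ /= sub0r normrN => hd.
  rewrite !fctE /= Hx Hd ?addr0 ?subrr ?normr0 ?mulr_ge0 ?(ltW e0) //.
  by rewrite /ball_ /= opprD addrCA subrr addr0 normrN.
have dH : 'd H x = \0 :> (V -> W) by apply: diff_unique HE => // ?; exact: cvg_cst.
have diffH : differentiable H x.
  by apply/diff_locallyP; rewrite dH; split=> // ?; exact: cvg_cst.
by split=> // v; rewrite deriveE // dH.
Qed.

Lemma diff_near_eq (R : numFieldType) (V W : normedModType R) (F G : V -> W) (x : V) :
  (\forall z \near x, F z = G z) -> differentiable F x ->
  differentiable G x /\ forall v, 'D_v G x = 'D_v F x.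
Proof.
move=> FG dF; have [|dH DH] := @diff_near_0 _ _ _ (G - F) x.
  by apply: filterS FG => z /= FGz; rewrite !fctE FGz subrr.
have GE : G = F + (G - F) by rewrite addrC subrK.
split=> [|v]; first by rewrite GE; exact: differentiableD.
by rewrite [in LHS]GE deriveD ?DH ?addr0 //; exact: diff_derivable.
Qed.

Lemma Ck_eq (R : realType) k (U : set 'rV[R]_2) (F G : 'rV[R]_2 -> 'rV[R]_3) :
  open U -> (forall w, U w -> F w = G w) -> Ck k U F -> Ck k U G.
Proof.
move=> oU; elim: k F G => [|k IH] F G FG.
  move=> cF w Uw; have near_FG : \forall z \near w, F z = G z.
    by apply: filterS (open_nbhs_nbhs (conj oU Uw)).
  suff : G @ w --> F w by rewrite (FG w Uw).
  apply: cvg_trans (cF w Uw).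
  exact: near_eq_cvg near_FG.
move=> [dF CF].
have dG w : U w -> differentiable G w /\ forall v, 'D_v G w = 'D_v F w.
  move=> Uw; apply: diff_near_eq; last exact: dF.
  by apply: filterS (open_nbhs_nbhs (conj oU Uw)).
split=> [w /dG[]//|v]; by apply: (IH ('D_v F)); [move=> w /dG[_ ->]|exact: CF].
Qed.

Lemma mulmxr_continuous (R : realType) n p (M : 'M[R]_(n, p)) :
  continuous (fun X : 'rV[R]_n => X *m M).
Proof.
apply/(@continuous_subspace_setT _ _ (fun X : 'rV[R]_n => X *m M)).
apply: (@lipschitz_within _ _ _ _ _ (n%:R * `|M|)) => X Y _ _.
by rewrite -mulmxBl (le_trans (norm_mulmx_le _ _)) // mulrAC.
Qed.

Definition affine (R : realType) n (M : 'M[R]_n) (b X : 'rV[R]_n) : 'rV[R]_n :=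
  X *m M + b.

Lemma affine_continuous (R : realType) n (M : 'M[R]_n) (b : 'rV[R]_n) :
  continuous (affine M b).
Proof.
apply/continuous_subspace_setT.
apply: (@lipschitz_within _ _ _ _ _ (n%:R * `|M|)) => X Y _ _.
by rewrite /affine opprD addrACA subrr addr0 -mulmxBl (le_trans (norm_mulmx_le _ _)) // mulrAC.
Qed.

Lemma affine_diff (R : realType) n (V : normedModType R) (M : 'M[R]_n) (b : 'rV[R]_n)
    (F : V -> 'rV[R]_n) (x : V) : differentiable F x ->
  differentiable (affine M b \o F) x /\
  forall v, 'D_v (affine M b \o F) x = 'D_v F x *m M.
Proof.
move=> dF.
have lin y : is_diff y (mulmxr M : 'rV[R]_n -> 'rV[R]_n) (mulmxr M : 'rV[R]_n -> 'rV[R]_n).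
  have cM : continuous (mulmxr M : 'rV[R]_n -> 'rV[R]_n) by exact: mulmxr_continuous.
  by apply: DiffDef; [exact: linear_differentiable|rewrite diff_lin].
have aff y : is_diff y (affine M b) (mulmxr M : 'rV[R]_n -> 'rV[R]_n).
  have : is_diff y ((mulmxr M : 'rV[R]_n -> 'rV[R]_n) + cst b) ((mulmxr M : 'rV[R]_n -> 'rV[R]_n) + 0).
    exact: is_diffD.
  by rewrite addr0.
have da : differentiable (affine M b) (F x) by [].
split=> [|v]; first exact: differentiable_comp.
rewrite deriveE; last exact: differentiable_comp.
by rewrite diff_comp // /= diff_val deriveE.
Qed.

Lemma affine_derive (R : realType) n (M : 'M[R]_n) (b : 'rV[R]_n) (X v : 'rV[R]_n) :
  'D_v (affine M b) X = v *m M.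
Proof.
have [_ /(_ v)] := @affine_diff R n _ M b id X ltac:(by []).
by rewrite derive_id.
Qed.

Lemma Ck_affine (R : realType) k (U : set 'rV[R]_2) (M : 'M[R]_3) (b : 'rV[R]_3)
    (F : 'rV[R]_2 -> 'rV[R]_3) : open U -> Ck k U F -> Ck k U (affine M b \o F).
Proof.
move=> oU; elim: k b F => [|k IH] b F.
  move=> cF w Uw; apply: continuous_comp; first exact: cF.
  exact: affine_continuous.
move=> [dF CF]; split=> [w Uw|v]; first by have [] := affine_diff M b (dF w Uw).
(* Differentiation removes the translation, so the induction continues with 0 in place of [b]. *)
apply: Ck_eq (IH 0 _ (CF v)) => // w Uw.
by have [_ ->] := affine_diff M b (dF w Uw); rewrite /affine /= addr0.
Qed.

(** * Contact of surfaces *)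

Section AffineImage.
Variables (R : realType) (M : 'M[R]_3) (b : 'rV[R]_3).
Hypothesis M_orthogonal : M *m M^T = 1%:M.

Let trM_M : M^T *m M = 1%:M. Proof. exact: mulmx1C. Qed.

Lemma dot_orthogonal (v w : 'rV[R]_3) : dot (v *m M) (w *m M) = dot v w.
Proof. by rewrite !dotE trmx_mul -mulmxA (mulmxA M) M_orthogonal mul1mx. Qed.

Lemma dot_orthogonalC (v w : 'rV[R]_3) : dot (v *m M) w = dot v (w *m M^T).
Proof. by rewrite -(dot_orthogonal v) -mulmxA trM_M mulmx1. Qed.

Lemma affine_isometry : Defs.isometry (affine M b).
Proof.
move=> X Y; rewrite /affine opprD addrACA subrr addr0 -mulmxBl.
by rewrite /enorm dot_orthogonal.
Qed.

Lemma affineK X : affine M^T (- (b *m M^T)) (affine M b X) = X.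
Proof. by rewrite /affine mulmxDl -mulmxA M_orthogonal mulmx1 addrK. Qed.

Lemma local_param_affine (D : set 'rV[R]_2) (T : topologicalType)
    (psi : T -> 'rV[R]_3) (p : T) (F : 'rV[R]_2 -> 'rV[R]_3) :
  local_param D psi p F -> local_param D (affine M b \o psi) p (affine M b \o F).
Proof.
move=> [U [V [x [y [[U0 oV] x0 hxy psiF [sF iF]]]]]].
exists U, V, x, y; split=> // [w /psiF /= -> //|].
have oU := U0.1; split=> [k|w v Uw]; first exact: Ck_affine.
have [dF _] := sF 1%N; have [_ ->] := affine_diff M b (dF w Uw.1).
move=> DM; apply: (iF w v Uw).
by rewrite -[LHS]mulmx1 -M_orthogonal mulmxA DM mul0mx.
Qed.

End AffineImage.

Section AffineSurface.
Variables (R : realType) (M : 'M[R]_3) (b : 'rV[R]_3).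
Hypothesis M_orthogonal : M *m M^T = 1%:M.

Let trM_orthogonal : M^T *m M^T^T = 1%:M.
Proof. by rewrite trmxK; exact: mulmx1C. Qed.

(** The tangent plane of the image ranges over all its parametrizations, which have to be pulled
    back to those of the original map. *)
Lemma local_param_affineV (D : set 'rV[R]_2) (T : topologicalType)
    (psi : T -> 'rV[R]_3) (p : T) (F : 'rV[R]_2 -> 'rV[R]_3) :
  local_param D (affine M b \o psi) p F ->
  local_param D psi p (affine M^T (- (b *m M^T)) \o F).
Proof.
move=> /(local_param_affine (- (b *m M^T)) trM_orthogonal).
rewrite (_ : _ \o (_ \o psi) = psi) //; apply/funext => q /=.
exact: affineK.
Qed.

Variable S : surface R.

Let psi := affine M b \o @immersion R S.

Lemma affine_surface_locally p : interior_point psi p \/ boundary_point psi p.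
Proof.
have [[F HF]|[F HF]] := surface_locally p; [left|right]; exists (affine M b \o F);
  exact: local_param_affine.
Qed.

Lemma affine_normal_continuous : continuous (fun p => @normal R S p *m M).
Proof.
by move=> p; apply: (@continuous_comp _ _ _ (@normal R S) (fun X : 'rV[R]_3 => X *m M)); [exact: normal_continuous|exact: mulmxr_continuous].
Qed.

Lemma affine_normal_unit (p : carrier S) : enorm (normal p *m M) = 1.
Proof. by rewrite /enorm dot_orthogonal //; exact: normal_unit. Qed.

Lemma derive_local_param (D : set 'rV[R]_2) (T : topologicalType)
    (f : T -> 'rV[R]_3) (p : T) (F : 'rV[R]_2 -> 'rV[R]_3) :
  local_param D f p F -> differentiable F 0.
Proof.
move=> [U [V [x [y [[[oU U0] _] _ _ _ [sF _]]]]]].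
by have [dF _] := sF 1%N; exact: dF.
Qed.

Lemma affine_normal_orthogonal p v :
  tangent_plane psi p v -> dot v (normal p *m M) = 0.
Proof.
move=> [F [w [HF ->]]].
have dF : differentiable F 0 by case: HF; exact: derive_local_param.
have : tangent_plane (@immersion R S) p ('D_w F 0 *m M^T).
  exists (affine M^T (- (b *m M^T)) \o F), w.
  have [_ ->] := affine_diff M^T (- (b *m M^T)) dF; split=> //.
  by case: HF => /local_param_affineV ?; [left|right].
by move/normal_orthogonal => <-; rewrite dotC dot_orthogonalC // dotC.
Qed.

(** The carrier is kept, so that a point of [S] is also a point of its image. *)
Definition affine_surface : surface R :=
  @Surface R (carrier S) psi (fun p => normal p *m M)
    (@surface_hausdorff R S) (@surface_second_countable R S)
    (@surface_connected R S) (@surface_nonempty R S) affine_surface_locally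
    affine_normal_continuous affine_normal_unit affine_normal_orthogonal.

Lemma affine_surface_image : isometric_image (affine M b) S affine_surface.
Proof.
exists id, id; split=> //; last by move=> q; rewrite affine_derive.
by split=> //; split; apply: continuous_subspaceT => x; exact: cvg_id.
Qed.

Lemma affine_surface_family (A : surface R -> Prop) :
  hopf_family A -> A S -> A affine_surface.
Proof.
move=> [AI _ _ _] AS; apply: AI AS (affine_isometry b M_orthogonal) _.
exact: affine_surface_image.
Qed.

End AffineSurface.

(** The inverse of an embedding is continuous, so no other sheet comes near [immersion q]: local
    statements on the carrier become statements on the image. *)
Lemma embedded_range_nbhs (R : realType) (S : surface R) (q : carrier S)
    (V : set (carrier S)) : embedded S -> nbhs q V -> exists2 d, 0 < d &
  forall Y, range (@immersion R S) Y -> `|Y - immersion q| < d ->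
    exists2 m, V m & immersion m = Y.
Proof.
move=> [g [[_ cg] _ _ gK imK]] qV.
have cgq : g @ within (range (@immersion R S)) (nbhs (immersion q)) -->
    g (immersion q).
  by move/subspace_continuousP : cg; apply; exists q.
rewrite gK // in cgq.
have : \forall Y \near immersion q, range (@immersion R S) Y -> V (g Y) := cgq V qV.
move=> /nbhs_normP[d /= d0 dP].
exists d => // Y GY Yd; exists (g Y); last exact: imK.
by apply: dP => //; rewrite /ball_ /= distrC.
Qed.

Section InteriorPoint.
Variables (R : realType) (S : surface R) (q : carrier S).
Hypothesis S_embedded : embedded S.
Hypothesis q_interior : interior_point (@immersion R S) q.
Local Notation G := (range (@immersion R S)).
Local Notation X := (@immersion R S q).
Local Notation N := (@normal R S q).

Lemma normal_dot : dot N N = 1.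
Proof. by rewrite -enorm_sqr normal_unit expr1n. Qed.

Lemma interior_immersion : exists F : 'rV[R]_2 -> 'rV[R]_3,
  [/\ local_param setT (@immersion R S) q F, F 0 = X,
    \forall a \near (0 : 'rV[R]_2), differentiable F a,
    forall v, {for 0, continuous ('D_v F)} & forall v, 'D_v F 0 = 0 -> v = 0].
Proof.
have [F HF] := q_interior; exists F; have HF' := HF.
case: HF' => U [V [x [y [[[oU U0] oV] x0 hxy psiF [sF iF]]]]].
have [dF _] := sF 1%N; have [_ CF] := sF 1%N.
split=> //.
- by rewrite -psiF ?x0 //; split.
- by apply: filterS (open_nbhs_nbhs (conj oU U0)) => w Uw; exact: dF.
- by move=> v; exact: (CF v 0 U0).
- by move=> v; apply: iF; split.
Qed.

(** The normal alone determines the tangent plane; tangency at a contact then follows from equality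
    of the normals. *)
Lemma interior_tangent_plane : tangent_plane (@immersion R S) q = [set v | dot v N = 0].
Proof.
have [F [HF F0 dF cF iF]] := interior_immersion.
apply/seteqP; split=> v /=; first exact: normal_orthogonal.
have NF w : dot ('D_w F 0) N = 0.
  by apply: normal_orthogonal; exists F, w; split=> //; left.
move=> /(immersion_tangent_plane dF iF normal_dot NF)[w ->].
by exists F, w; split=> //; left.
Qed.

(** This and [interior_cover] are the local properties from which [graph_sides] is deduced, here for
    the image of an embedded surface. *)
Lemma interior_tangent e : 0 < e -> exists2 d, 0 < d & forall Y Z,
  G Y -> G Z -> `|Y - X| < d -> `|Z - X| < d -> `|dot (Z - Y) N| <= e * `|Z - Y|.
Proof.
move=> e0; have [F [HF F0 dF cF iF]] := interior_immersion.
have NF w : dot ('D_w F 0) N = 0.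
  by apply: normal_orthogonal; exists F, w; split=> //; left.
have [c c0 cP] := immersion_tangent_bound dF cF iF normal_dot NF e0.
case: HF => U [V [x [y [[[oU U0] oV] x0 [[cx cy] xV yU yx xy] psiF _]]]].
have qV : V q by rewrite -x0; apply: xV; split.
have : nbhs q [set m | V m /\ `|y m| < c].
  have cyq : y @ within V (nbhs q) --> y q.
    by move/subspace_continuousP : cy; apply.
  have yq : y q = 0 by rewrite -x0 yx //; split.
  have : nbhs (y q) [set a : 'rV[R]_2 | `|a| < c].
    rewrite yq -[nbhs _ _]/(\forall a \near (0 : 'rV[R]_2), `|a| < c).
    apply/nbhs_normP; exists c => // a.
    by rewrite /ball_ /= sub0r normrN.
  move=> /cyq yc; have {}yc : \forall m \near q, V m -> `|y m| < c := yc.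
  by apply: filterS2 (open_nbhs_nbhs (conj oV qV)) yc => m Vm /(_ Vm).
move=> /(embedded_range_nbhs S_embedded)[d d0 dP]; exists d => // Y Z GY GZ Yd Zd.
have [m [Vm mc] <-] := dP _ GY Yd; have [n [Vn nc] <-] := dP _ GZ Zd.
by rewrite -(xy m Vm) -(xy n Vn) !psiF; [exact: cP|exact: yU..].
Qed.

Lemma interior_cover e : 0 < e -> exists2 d, 0 < d & forall Z,
  `|Z - X| < d -> exists2 t, `|t| < e & G (Z + t *: N).
Proof.
move=> e0; have [F [HF F0 dF cF iF]] := interior_immersion.
have NF w : dot ('D_w F 0) N = 0.
  by apply: normal_orthogonal; exists F, w; split=> //; left.
case: HF => U [V [x [y [[U0 _] _ _ psiF _]]]].
have : \forall a \near (0 : 'rV[R]_2), U a := open_nbhs_nbhs U0.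
move=> /nbhs_normP[c /= c0 cU].
have ec : 0 < Num.min e c by rewrite lt_min e0.
have [d d0 dP] := immersion_locally_surjective dF cF iF normal_dot NF ec.
exists d => // Z; rewrite -F0 => /dP[a [t [+ + ZF]]].
rewrite !lt_min => /andP[_ ac] /andP[te _]; exists t => //.
exists (x a) => //; rewrite ZF; apply: psiF; split=> //.
by apply: cU; rewrite /ball_ /= sub0r normrN.
Qed.

End InteriorPoint.

Lemma vec3_0 (R : realType) (a b c : R) : vec3 a b c 0 0 = a.
Proof. by rewrite mxE. Qed.

Lemma vec3_1 (R : realType) (a b c : R) : vec3 a b c 0 1 = b.
Proof. by rewrite mxE. Qed.

Lemma vec3_2 (R : realType) (a b c : R) : vec3 a b c 0 ord_max = c.
Proof. by rewrite mxE. Qed.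

Definition vec3E := (vec3_0, vec3_1, vec3_2).

Lemma rV3P (R : realType) (X Y : 'rV[R]_3) :
  X 0 0 = Y 0 0 -> X 0 1 = Y 0 1 -> X 0 ord_max = Y 0 ord_max -> X = Y.
Proof.
move=> h0 h1 h2; apply/rowP => i; case: i => [[|[|[|//]]] hi].
- by rewrite (_ : Ordinal hi = 0) //; apply: val_inj.
- by rewrite (_ : Ordinal hi = 1) //; apply: val_inj.
- by rewrite (_ : Ordinal hi = ord_max) //; apply: val_inj.
Qed.

Lemma vec3_eta (R : realType) (X : 'rV[R]_3) : X = vec3 (X 0 0) (X 0 1) (X 0 ord_max).
Proof. by apply: rV3P; rewrite vec3E. Qed.

Lemma addZ_e3 (R : realType) (x y z t : R) : vec3 x y z + t *: e3 R = vec3 x y (z + t).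
Proof. by apply: rV3P; rewrite !mxE /=; ring. Qed.

Lemma dot3 (R : realType) (v w : 'rV[R]_3) :
  dot v w = v 0 0 * w 0 0 + v 0 1 * w 0 1 + v 0 ord_max * w 0 ord_max.
Proof.
rewrite /dot !big_ord_recr big_ord0 /= add0r; congr (_ * _ + _ * _ + _ * _);
  by congr (_ 0 _); apply: val_inj.
Qed.

Lemma norm_lt3 (R : realType) (X Y : 'rV[R]_3) (d : R) : 0 < d ->
  close d (X 0 0) (Y 0 0) -> close d (X 0 1) (Y 0 1) ->
  close d (X 0 ord_max) (Y 0 ord_max) -> `|Y - X| < d.
Proof.
move=> d0 h0 h1 h2; rewrite [ltLHS]mx_normrE; apply: bigmax_lt => // -[i j] _ /=.
rewrite !mxE ltr_norml (ord1 i); case: j => [[|[|[|//]]] hj].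
- by rewrite (_ : Ordinal hj = 0); [move: h0; rewrite /close; lra|apply: val_inj].
- by rewrite (_ : Ordinal hj = 1); [move: h1; rewrite /close; lra|apply: val_inj].
- by rewrite (_ : Ordinal hj = ord_max); [move: h2; rewrite /close; lra|apply: val_inj].
Qed.

Lemma close_entry (R : realType) (X Y : 'rV[R]_3) (d : R) i :
  `|Y - X| < d -> close d (X 0 i) (Y 0 i).
Proof.
move=> Yd; have := le_lt_trans (entry_le_norm (Y - X) 0 i) Yd.
by rewrite !mxE ltr_norml /close => ?; lra.
Qed.

Lemma unit_vector_eq (R : realType) (m n : 'rV[R]_3) :
  dot m m = 1 -> dot n n = 1 -> (forall v, 0 < dot v m -> 0 <= dot v n) -> m = n.
Proof.
move=> m1 n1 mn; set c := dot m n.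
have c0 : 0 <= c by apply: mn; rewrite m1.
have c1 : 1 <= c.
  rewrite leNgt; apply/negP => c1.
  (* Its product with [m] is [(1 - c ^+ 2) / 2], positive, and its product with [n] is
     [(1 - c ^+ 2) * (c / 2 - 1)], negative. *)
  have := mn ((c + (1 - c ^+ 2) / 2) *: m - n).
  rewrite !dotBl !dotZl m1 n1 (dotC n) -/c mulr1.
  have c2 : 0 < 1 - c ^+ 2 by nra.
  by move=> /(_ ltac:(lra)); nra.
apply/eqP; rewrite -subr_eq0; apply/eqP/dot_eq0/eqP; rewrite eq_le dot_ge0 andbT.
by rewrite dotBl !dotBr m1 n1 (dotC n) -/c; lra.
Qed.

Lemma dot_continuous (R : realType) (T : topologicalType) (f g : T -> 'rV[R]_3) :
  continuous f -> continuous g -> continuous (fun p => dot (f p) (g p)).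
Proof.
move=> cf cg p; rewrite /continuous_at; under eq_fun do rewrite dot3; rewrite dot3.
have cc (h : T -> 'rV[R]_3) i : continuous h -> (fun p => h p 0 i) @ p --> h p 0 i.
  by move=> ch; apply: (@continuous_comp _ _ _ h (fun X : 'rV[R]_3 => X 0 i)); [exact: ch|exact: coord_continuous].
by apply: cvgD; [apply: cvgD|]; apply: cvgM; exact: cc.
Qed.

Lemma embedded_continuous (R : realType) (S : surface R) :
  embedded S -> continuous (@immersion R S).
Proof. by case=> g [[ci _] _ _ _ _]; apply/continuous_subspace_setT. Qed.

Lemma near_norm_lt (R : realType) (T : topologicalType) (f : T -> 'rV[R]_3) p (d : R) :
  continuous f -> 0 < d -> \forall x \near p, `|f x - f p| < d.
Proof.
move=> cf d0; have /cvgrPdist_lt/(_ d d0) := cf p.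
by apply: filterS => x; rewrite distrC.
Qed.

Lemma interior_contact (R : realType) (S1 S2 : surface R) (p : carrier S1)
    (q : carrier S2) : maximum_principle S1 S2 ->
  interior_point (@immersion R S1) p -> interior_point (@immersion R S2) q ->
  immersion p = immersion q -> normal p = normal q -> one_side p q ->
  embedded S2 ->
  exists2 d, 0 < d & forall Y, range (@immersion R S2) Y -> `|Y - immersion q| < d ->
    range (@immersion R S1) Y.
Proof.
move=> mp ip iq pq npq os emb; have [tang _] := mp p q npq os.
have [|V1 [V2 [_ qV2 VV]]] := tang.
  by split=> //; split=> //; rewrite !interior_tangent_plane // npq.
have [d d0 dP] := embedded_range_nbhs emb qV2; exists d => // Y GY Yd.
have [m Vm <-] := dP Y GY Yd.
have : ((@immersion R S2) @` V2) (immersion m) by exists m.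
by rewrite -VV => -[x _ <-]; exists x.
Qed.

(** * The unit normal of a round sphere *)

Section SphereNormal.
Variables (R : realType) (S : surface R) (c : 'rV[R]_3) (r : R).
Hypothesis r_gt0 : 0 < r.
Hypothesis S_embedded : embedded S.
Hypothesis S_boundaryless : without_boundary S.
Hypothesis S_sphere : range (@immersion R S) = esphere c r.

Lemma sphere_dot p : dot (@immersion R S p - c) (immersion p - c) = r ^+ 2.
Proof.
have : range (@immersion R S) (immersion p) by exists p.
by rewrite S_sphere => /= <-; rewrite enorm_sqr.
Qed.

Lemma sphere_interior p : interior_point (@immersion R S) p.
Proof. by have [//|/S_boundaryless] := surface_locally p. Qed.

Lemma sphere_tangent p v : dot v (@normal R S p) = 0 -> dot v (immersion p - c) = 0.
Proof.
move=> vN.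
have [F [HF F0X dF cF iF]] := interior_immersion (sphere_interior p).
have NF w : dot ('D_w F 0) (normal p) = 0.
  by apply: normal_orthogonal; exists F, w; split=> //; left.
have [w ->] := immersion_tangent_plane dF iF (normal_dot p) NF vN.
have d0 : differentiable F 0 := nbhs_singleton dF.
pose h i a : R := F a 0 i - c 0 i.
have dh i : is_derive (0 : 'rV[R]_2) w (h i) ('D_w F 0 0 i).
  have dw : derivable F 0 w by exact: diff_derivable.
  rewrite -[X in is_derive _ _ _ X]subr0; apply: is_deriveB.
  split; first by move/derivable_mxP : dw; apply.
  by rewrite derive_mx // mxE.
(* The squared distance to the centre minus [r ^+ 2], read in the parametrization: it vanishes near
   0, hence so does its derivative. *)
pose H := (\sum_(i < 3) (h i * h i)) - cst (r ^+ 2).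
have HD : is_derive (0 : 'rV[R]_2) w H (\sum_(i < 3) (h i 0 *: 'D_w F 0 0 i + h i 0 *: 'D_w F 0 0 i) - 0).
  by apply: is_deriveB.
have [|_ /(_ w)] := @diff_near_0 _ _ _ H (0 : 'rV[R]_2).
  case: HF => U [V [x [y [[oU oV] x0 hxy psiF _]]]].
  have : \forall a \near (0 : 'rV[R]_2), U a := open_nbhs_nbhs oU.
  apply: filterS => a Ua; rewrite /H !fctE fct_sumE; apply/eqP; rewrite subr_eq0; apply/eqP.
  rewrite -(sphere_dot (x a)) /dot psiF //; apply: eq_bigr => i _.
  by rewrite !fctE /h !mxE.
case: HD => _ -> /eqP; rewrite subr0 -F0X big_split /= -mulr2n mulrn_eq0 /= => /eqP <-.
by apply: eq_bigr => i _; rewrite !mxE mulrC.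
Qed.

Lemma sphere_normal_pm p :
  exists2 s, s ^+ 2 = r ^+ 2 & immersion p - c = s *: @normal R S p.
Proof.
set N := normal p; set v := immersion p - c.
have NN : dot N N = 1 by exact: normal_dot.
pose u := v - dot v N *: N.
have uN : dot u N = 0 by rewrite dotBl dotZl NN mulr1 subrr.
have uv : dot u v = 0 by exact: sphere_tangent.
have : u = 0 by apply: dot_eq0; rewrite {2}/u dotBr uv dotZr uN mulr0 subrr.
move=> /subr0_eq vE; exists (dot v N) => //.
by have := sphere_dot p; rewrite -/v {1 2}vE dotZl dotZr NN mulr1 expr2.
Qed.

(** The product of the radius vector with the normal takes only the values [r] and [- r], so it is
    constant by connectedness. The case [s = 1] is that of a normal pointing to the centre. *)
Lemma sphere_normal : exists2 s : R, s = 1 \/ s = -1 & forall p,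
  @normal R S p = s *: (r^-1 *: (c - immersion p)).
Proof.
pose f p := dot (immersion p - c) (@normal R S p).
have fE p : f p = r \/ f p = - r.
  have [s s2 pE] := sphere_normal_pm p.
  have -> : f p = s by rewrite /f pE dotZl normal_dot mulr1.
  by move/eqP : s2; rewrite eqf_sqr => /orP[]/eqP; [left|right].
have NE p : immersion p - c = f p *: @normal R S p.
  by have [s _ pE] := sphere_normal_pm p; rewrite /f pE dotZl normal_dot mulr1.
have cf : continuous f.
  apply: dot_continuous; last exact: normal_continuous.
  move=> p; apply: (@cvgB _ _ _ _ _ (@immersion R S) (cst c)); last exact: cvg_cst.
  exact: embedded_continuous.
have NE' (p : carrier S) (s : R) : s = 1 \/ s = -1 -> f p = - s * r ->
    normal p = s *: (r^-1 *: (c - immersion p)).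
  move=> s1 fp; rewrite -[c - _]opprB NE fp scalerN !scalerA -scaleNr scalerA.
  rewrite (_ : s * _ = 1) ?scale1r //.
  by case: s1 => ->; rewrite ?(mulNr, mulrN, opprK, mul1r, mulVf) ?gt_eqF.
have [p0 _] := surface_nonempty S.
have conn e : f p0 = e -> forall p, f p = e.
  move=> fe; have e0 : e = r \/ e = - r by rewrite -fe.
  have eE p : f p = e <-> 0 < e * f p.
    have rr : 0 < r * r by rewrite mulr_gt0.
    split=> [->|]; first by case: e0 => ->; rewrite ?mulrNN.
    by case: (fE p) => ->; case: e0 => -> //; rewrite ?mulNr ?mulrN oppr_gt0 ltNge (ltW rr).
  have closedB : closed (f @^-1` [set e]).
    by apply: closed_comp => [p _|]; [exact: cf|exact: closed_eq].
  have openB : open (f @^-1` [set x | 0 < e * x]).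
    apply: open_comp => [p _|]; first exact: cf.
    apply: (@open_comp _ _ (fun x => e * x) [set x | 0 < x]) => [x _|]; last exact: open_gt.
    by apply: cvgMr; exact: cvg_id.
  have BT : [set p | f p = e] = [set: carrier S].
    apply: (@surface_connected R S); first by exists p0.
    - by exists (f @^-1` [set x | 0 < e * x]) => //; apply/seteqP; split=> p /= => [/eE|[_ /eE]].
    - by exists (f @^-1` [set e]) => //; rewrite setTI.
  by move=> p; have : [set: carrier S] p by []; rewrite -BT.
have [fp|fp] := fE p0.
- exists (-1); [by right|move=> p]; apply: NE'; [by right|].
  by rewrite opprK mul1r; exact: conn.
- exists 1; [by left|move=> p]; apply: NE'; [by left|].
  by rewrite mulN1r; exact: conn.
Qed.

End SphereNormal.

Lemma near_gt (R : realType) (T : topologicalType) (f : T -> R) p (a : R) :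
  continuous f -> a < f p -> \forall x \near p, a < f x.
Proof.
move=> cf ap; have d0 : 0 < f p - a by rewrite subr_gt0.
have /cvgrPdist_lt/(_ _ d0) := cf p.
by apply: filterS => x; rewrite ltr_norml => ?; lra.
Qed.

Lemma near_lt (R : realType) (T : topologicalType) (f : T -> R) p (a : R) :
  continuous f -> f p < a -> \forall x \near p, f x < a.
Proof.
move=> cf pa; have d0 : 0 < a - f p by rewrite subr_gt0.
have /cvgrPdist_lt/(_ _ d0) := cf p.
by apply: filterS => x; rewrite ltr_norml => ?; lra.
Qed.

Definition inward (R : realType) (G : set 'rV[R]_3) (X n : 'rV[R]_3) : Prop :=
  [/\ exists2 d, 0 < d & forall Z t, `|Z - X| < d -> hypograph G Z -> 0 < t < d ->
        strict_hypograph G (Z + t *: n),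
      forall v, 0 < dot v n -> exists2 d, 0 < d & forall t, 0 < t < d ->
        strict_hypograph G (X + t *: v) &
      forall v, dot v n < 0 -> exists2 d, 0 < d & forall t, 0 < t < d ->
        strict_epigraph G (X + t *: v)].

(** * Contacts from inside, and the orientation of the graph *)

Section Graph.
Variables (R : realType) (S : surface R).
Local Notation G := (range (@immersion R S)).
Hypothesis S_embedded : embedded S.
Hypothesis S_compact : compact_surface S.
Hypothesis G_graph : forall Y t, G Y -> G (Y + t *: e3 R) -> t = 0.
Hypothesis S_interior : forall p : carrier S, 0 < (@immersion R S p) 0 ord_max ->
  interior_point (@immersion R S) p.

Let immersion_cont : continuous (@immersion R S) := embedded_continuous S_embedded.

Lemma graph_vertical_inj Y s t : G (Y + s *: e3 R) -> G (Y + t *: e3 R) -> s = t.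
Proof.
move=> Gs Gt; apply/esym/eqP; rewrite -subr_eq0; apply/eqP; apply: G_graph Gs _.
by rewrite -addrA -scalerDl addrCA subrr addr0.
Qed.

Lemma hypo_epi_disjoint Z : hypograph G Z -> strict_epigraph G Z -> False.
Proof. by move=> [s s0 Gs] [t t0 Gt]; have := graph_vertical_inj Gs Gt; lra. Qed.

Lemma strict_hypo_disjoint Z : strict_hypograph G Z -> G Z -> False.
Proof.
move=> [s s0 Gs] GZ; suff : s = 0 by move: s0 => /[swap] ->; rewrite ltxx.
by apply: graph_vertical_inj Gs _; rewrite scale0r addr0.
Qed.

Lemma strict_hypograph_hypo Z : strict_hypograph G Z -> hypograph G Z.
Proof. by move=> [t t0 Gt]; exists t => //; exact: ltW. Qed.

Lemma graph_hypograph Z : G Z -> hypograph G Z.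
Proof. by move=> GZ; exists 0; rewrite ?scale0r ?addr0. Qed.

Lemma graph_inward q : interior_point (@immersion R S) q ->
  exists2 s : R, s = 1 \/ s = -1 & inward G (immersion q) (s *: normal q).
Proof.
move=> iq; have GX : G (immersion q) by exists q.
have [s [s1 _ b c c']] := graph_sides GX G_graph (normal_dot q)
  (interior_tangent S_embedded iq) (interior_cover iq).
by exists s.
Qed.

Lemma graph_open q : interior_point (@immersion R S) q -> forall e, 0 < e ->
  exists2 d, 0 < d & forall Z, `|Z - immersion q| < d ->
    exists2 t, `|t| < e & G (Z + t *: e3 R).
Proof.
move=> iq; have GX : G (immersion q) by exists q.
by have [s []] := graph_sides GX G_graph (normal_dot q)
  (interior_tangent S_embedded iq) (interior_cover iq).
Qed.

Lemma inward_unique X n : dot n n = 1 -> inward G X n -> inward G X (- n) -> False.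
Proof.
move=> n1 [_ + _] [_ _ +] => /(_ n) + /(_ n).
rewrite dotNr n1 ltr01 oppr_lt0 ltr01 => /(_ isT)[d d0 dP] /(_ isT)[e e0 eP].
have m0 : 0 < Num.min d e by rewrite lt_min d0.
have ht : 0 < Num.min d e / 2 < d /\ 0 < Num.min d e / 2 < e.
  have : Num.min d e <= d by rewrite ge_min lexx.
  have : Num.min d e <= e by rewrite ge_min lexx orbT.
  by move=> *; split; lra.
apply: hypo_epi_disjoint (eP _ ht.2).
exact/strict_hypograph_hypo/dP/ht.1.
Qed.

(** The vectors [m] and [n] agree, because a direction positive on [m] and negative on [n] would
    lead both under and over the graph. Then moving from a point of [S1] along [n] goes strictly
    under the graph, so [S] is met only in the opposite direction. *)
Lemma inside_contact (S1 : surface R) (p : carrier S1) (q : carrier S)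
    (s : R) (m n : 'rV[R]_3) :
  maximum_principle S1 S -> continuous (@immersion R S1) ->
  interior_point (@immersion R S1) p -> interior_point (@immersion R S) q ->
  immersion p = immersion q -> s = 1 \/ s = -1 ->
  normal p = s *: m -> normal q = s *: n -> inward G (immersion q) n ->
  (\forall x \near p, hypograph G (@immersion R S1 x)) ->
  (forall v, 0 < dot v m -> exists2 d, 0 < d & forall t, 0 < t < d ->
     hypograph G (@immersion R S q + t *: v)) ->
  exists2 d, 0 < d & forall Y, G Y -> `|Y - immersion q| < d ->
    range (@immersion R S1) Y.
Proof.
move=> mp c1 ip iq pq s1 pm qn [hb hc hc'] near_hyp cone.
have unit_of (N k : 'rV[R]_3) : dot N N = 1 -> N = s *: k -> dot k k = 1.
  move=> + NE; rewrite NE dotZl dotZr mulrA; case: s1 => ->; first by rewrite !mul1r.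
  by rewrite mulrNN !mul1r.
have n1 : dot n n = 1 := unit_of _ _ (normal_dot q) qn.
have m1 : dot m m = 1 := unit_of _ _ (normal_dot p) pm.
have mn : m = n.
  apply: unit_vector_eq => // v vm; rewrite leNgt; apply/negP => vn.
  have [d d0 dP] := cone v vm; have [e e0 eP] := hc' v vn.
  have m0 : 0 < Num.min d e by rewrite lt_min d0.
  have ht : 0 < Num.min d e / 2 < d /\ 0 < Num.min d e / 2 < e.
    have : Num.min d e <= d by rewrite ge_min lexx.
    have : Num.min d e <= e by rewrite ge_min lexx orbT.
    by move=> *; split; lra.
  exact: hypo_epi_disjoint (dP _ ht.1) (eP _ ht.2).
apply: (interior_contact mp ip iq pq _ _ S_embedded); first by rewrite pm qn mn.
have [d d0 dP] := hb.
have n0 : `|n| <= 1 by rewrite (le_trans (norm_le_enorm n)) // /enorm n1 sqrtr1.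
(* Two distances below [d / 6], times the factor 3 of [dot_le_norm], keep [t * s] below [d]. *)
have d6 : 0 < d / 6 by rewrite divr_gt0.
have side : heights_near p q (fun t => t * s <= 0).
  exists ([set x | hypograph G (@immersion R S1 x) /\ `|immersion x - immersion p| < d / 6],
          [set y | `|@immersion R S y - immersion q| < d / 6]).
    by split => /=; [apply: filterI => //|]; apply: near_norm_lt.
  move=> [x y] [/= [hx xp] yq] t yE; rewrite leNgt; apply/negP => ts.
  have yE' : immersion y = immersion x + (t * s) *: n.
    by rewrite yE pm mn scalerA.
  have td : t * s < d.
    have -> : t * s = dot (immersion y - immersion x) n.
      by rewrite yE' addrC addKr dotZl n1 mulr1.
    apply: le_lt_trans (ler_norm _) _; apply: le_lt_trans (dot_le_norm _ _) _.
    have := ler_normB (immersion y - immersion q) (immersion x - immersion p).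
    rewrite -pq opprB addrA subrK; rewrite -pq in yq.
    by move: (normr_ge0 (immersion y - immersion x)) (normr_ge0 n) => *; nra.
  apply: (@strict_hypo_disjoint (immersion x + (t * s) *: n)); last by rewrite -yE'; exists y.
  by apply: dP; rewrite ?ts //; rewrite -pq; apply: lt_trans xp _; lra.
case: s1 side => -> side; [right|left]; move: side; rewrite /heights_near;
  apply: filterS => -[x y] /= h t /h; lra.
Qed.

Section Orientation.
Variables (r s : R).
Hypothesis r_gt0 : 0 < r.
Hypothesis s_pm1 : s = 1 \/ s = -1.
Hypothesis sphere_at : forall C X : 'rV[R]_3, dot (X - C) (X - C) = r ^+ 2 ->
  exists (S1 : surface R) (p : carrier S1),
    [/\ maximum_principle S1 S, interior_point (@immersion R S1) p, immersion p = X,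
        normal p = s *: (r^-1 *: (C - X)) &
        forall Y, range (@immersion R S1) Y -> dot (Y - C) (Y - C) = r ^+ 2].

(** The part of S above the plane may be disconnected, so the sign cannot be propagated from the top
    of S. Instead [K] collects the wrongly oriented points at least as high as [q]. A highest point
    of [K] is a local maximum of the height on S, because the sign is locally constant, and the
    sphere is placed there. *)
Lemma orientation q : 0 < (@immersion R S q) 0 ord_max ->
  inward G (immersion q) (s *: normal q).
Proof.
have ss : s * s = 1 by case: s_pm1 => ->; lra.
have ns1 : - s = 1 \/ - s = -1 by case: s_pm1 => ->; rewrite ?opprK; [right|left].
have dot_sn (x : carrier S) u : u * u = 1 -> dot (u *: normal x) (u *: @normal R S x) = 1.
  by move=> uu; rewrite dotZl dotZr normal_dot mulr1 uu.
pose ht (x : carrier S) : R := (@immersion R S x) 0 ord_max.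
have cht : continuous ht.
  by move=> q'; apply: (@continuous_comp _ _ _ (@immersion R S) (fun X : 'rV[R]_3 => X 0 ord_max)); [exact: immersion_cont|exact: coord_continuous].
(* If the sign changed at a nearby [q'], the direction [u *: normal q0] would lead from [q'] both
   under and over the graph. Normals within 1/4 have positive product, as 3/4 < 1. *)
have loc (q0 : carrier S) u : 0 < ht q0 -> u = 1 \/ u = -1 ->
    inward G (immersion q0) (u *: normal q0) ->
    \forall q' \near q0, inward G (immersion q') (u *: normal q').
  move=> hq0 u1 in0; have uu : u * u = 1 by case: u1 => ->; lra.
  have [[d d0 dP] _ _] := in0.
  have n2 : 0 < (1 / 4 : R) by rewrite divr_gt0.
  have N1 : \forall q' \near q0, `|@normal R S q' - normal q0| < 1 / 4.
    exact: (near_norm_lt q0 (@normal_continuous R S) n2).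
  have N2 : \forall q' \near q0, `|@immersion R S q' - immersion q0| < d.
    exact: near_norm_lt.
  have N3 : \forall q' \near q0, 0 < ht q'.
    exact: near_gt.
  apply: filterS3 N1 N2 N3 => q' n1 n2' h'.
  have [w w1 inw] := graph_inward (S_interior h').
  have [-> //|wu] := eqVneq u w; exfalso.
  have wE : w = - u.
    by case: u1 w1 wu => -> [] -> //; rewrite ?eqxx ?opprK.
  have [_ _ /(_ (u *: normal q0))] := inw.
  rewrite wE dotZl dotZr mulrA mulrN uu mulN1r oppr_lt0.
  have -> : 0 < dot (normal q0) (normal q').
    have := dot_le_norm (normal q' - normal q0) (normal q0).
    rewrite dotBl normal_dot dotC ler_norml.
    have : `|normal q0| <= 1 by rewrite (le_trans (norm_le_enorm _)) // normal_unit.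
    move: (normr_ge0 (normal q0)) (normr_ge0 (normal q' - normal q0)).
    by move=> *; nra.
  move=> /(_ isT)[e e0 eP].
  have m0 : 0 < Num.min d e by rewrite lt_min d0.
  have hh : 0 < Num.min d e / 2 < d /\ 0 < Num.min d e / 2 < e.
    have : Num.min d e <= d by rewrite ge_min lexx.
    have : Num.min d e <= e by rewrite ge_min lexx orbT.
    by move=> *; split; lra.
  apply: hypo_epi_disjoint (eP _ hh.2).
  apply/strict_hypograph_hypo/dP => //; last exact: hh.1.
  by apply: graph_hypograph; exists q'.
move=> hq; have [u u1 inu] := graph_inward (S_interior hq).
have [<- //|us] := eqVneq u s; exfalso.
have inq : inward G (immersion q) ((- s) *: normal q).
  suff <- : u = - s by [].
  by case: u1 s_pm1 us => -> [] -> //; rewrite ?eqxx ?opprK.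
pose K := [set x : carrier S | ht q <= ht x /\ inward G (immersion x) ((- s) *: normal x)].
have cK : closed K.
  rewrite -openC openE => x /= nK; rewrite /interior.
  have [hx|hx] := ltP (ht x) (ht q).
    have : \forall y \near x, ht y < ht q by exact: near_lt.
    by apply: filterS => y hy [hy' _]; lra.
  have hx0 : 0 < ht x by exact: lt_le_trans hx.
  have [w w1 inw] := graph_inward (S_interior hx0).
  have wE : w = s.
    have [//|ws] := eqVneq w s; exfalso; apply: nK; split=> //.
    suff <- : w = - s by [].
    by case: w1 s_pm1 ws => -> [] -> //; rewrite ?eqxx ?opprK.
  rewrite wE in inw; have := loc x s hx0 s_pm1 inw.
  apply: filterS => y iny [_ iny']; apply: inward_unique iny _; first exact: dot_sn.
  by rewrite -scaleNr.
have [|||q0 /set_mem [hq0 inq0] maxq0] := @compact_EVT_max _ R ht K.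
- by exists q.
- by apply: (subclosed_compact cK S_compact).
- exact: continuous_subspaceT.
have hq00 : 0 < ht q0 by exact: lt_le_trans hq0.
pose X := @immersion R S q0.
have near_max : \forall y \near q0, ht y <= ht q0.
  have := loc q0 (- s) hq00 ns1 inq0; apply: filterS => y iny.
  have [hy|hy] := leP (ht q) (ht y); first by apply: maxq0; rewrite inE.
  by rewrite (le_trans (ltW hy)).
have [d d0 dmax] := embedded_range_nbhs S_embedded near_max.
have {}dmax Y : G Y -> `|Y - X| < d -> Y 0 ord_max <= X 0 ord_max.
  by move=> GY /(dmax _ GY)[y hy <-].
have opq0 := graph_open (S_interior hq00).
have NE : @normal R S q0 = s *: e3 R.
  have mm : dot (- e3 R) (- e3 R) = 1 by rewrite dot3 !mxE /=; lra.
  have nn : dot ((- s) *: normal q0) ((- s) *: @normal R S q0) = 1.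
    by apply: dot_sn; rewrite mulrNN.
  suff /eqP : - e3 R = (- s) *: normal q0.
    by rewrite scaleNr eqr_opp => /eqP ->; rewrite scalerA ss scale1r.
  (* If a descending [v] led over the graph, the ascending [- v] would lead under it, giving graph
     points higher than the local maximum. *)
  apply: unit_vector_eq => // v; rewrite dot3 !mxE /= => vz.
  have [_ cone _] := inq0; rewrite leNgt; apply/negP => vn.
  have [|c c0 cP] := cone (- v); first by rewrite dotNl oppr_gt0.
  have d2 : 0 < d / 2 by rewrite divr_gt0.
  have [e e0 eP] := opq0 _ d2.
  pose m := Num.min c (Num.min e (d / 2) / (`|v| + 1)).
  have v1 : 0 < `|v| + 1 by rewrite ltr_wpDl.
  have ed0 : 0 < Num.min e (d / 2) by rewrite lt_min e0.
  have m0 : 0 < m by rewrite lt_min c0; exact: divr_gt0.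
  have mc' : m <= c by rewrite ge_min lexx.
  have mc : m / 2 < c by lra.
  have mv : `|(m / 2) *: (- v)| < Num.min e (d / 2).
    have : m * (`|v| + 1) <= Num.min e (d / 2).
      by rewrite -ler_pdivlMr // ge_min lexx orbT.
    apply: lt_le_trans; rewrite normrZ normrN gtr0_norm; last by rewrite divr_gt0.
    by move: (normr_ge0 v) => *; nra.
  move: mv; rewrite lt_min => /andP[me md].
  pose Z := X + (m / 2) *: (- v).
  have ZX : Z - X = (m / 2) *: (- v) by rewrite /Z addrC addKr.
  have [t td Gt] : exists2 t, `|t| < d / 2 & G (Z + t *: e3 R) by apply: eP; rewrite -/X ZX.
  have [w w0 Gw] : strict_hypograph G Z by apply: cP; rewrite mc andbT divr_gt0.
  have wt := graph_vertical_inj Gw Gt.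
  have := dmax _ Gt; rewrite addrAC ZX.
  have -> : `|(m / 2) *: (- v) + t *: e3 R| < d.
    rewrite (le_lt_trans (ler_normD _ _)) // [X in _ + X]normrZ.
    have := norm_e3 R; by move: (normr_ge0 t) (normr_ge0 (e3 R)) => *; nra.
  move=> /(_ isT); rewrite /Z !mxE /= -wt; nra.
(* The sphere that rests on the local maximum from above; its normal there is [s *: e3 R], like that
   of S. *)
pose C := X + r *: e3 R.
have XC : dot (X - C) (X - C) = r ^+ 2.
  by rewrite /C opprD addrA subrr add0r dotNl dotNr opprK dot3 !mxE /=; ring.
have CX : r^-1 *: (C - X) = e3 R.
  by rewrite /C addrC addKr scalerA mulVf ?scale1r // gt_eqF.
have [S1 [p [mp ip pX pN S1C]]] := sphere_at XC.
have [||e e0 eP] := interior_contact mp ip (S_interior hq00) pX _ _ S_embedded.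
- by rewrite pN NE CX.
- have high x : X 0 ord_max <= (@immersion R S1 x) 0 ord_max.
    have : range (@immersion R S1) (immersion x) by exists x.
    move=> /S1C; rewrite dot3 /C !mxE /=; set z := immersion x 0 ord_max => h.
    have : - r <= z - (X 0 ord_max + r * 1) <= r.
      apply: sqr_le_range; first exact: ltW.
      rewrite -h -!expr2; have := sqr_ge0 (immersion x 0 0 - (X 0 0 + r * 0)).
      by have := sqr_ge0 (immersion x 0 1 - (X 0 1 + r * 0)); lra.
    by lra.
  have side : heights_near p q0 (fun t => t * s <= 0).
    exists (setT, [set y | ht y <= ht q0]).
      by split => //=; exact: filterT.
    move=> [x y] [/= _ hy] t yE.
    have : immersion y 0 ord_max = immersion x 0 ord_max + t * s.
      by rewrite yE pN CX !mxE /= mulr1.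
    by have := high x; move: hy; rewrite /ht -/X => *; lra.
  by case: s_pm1 side => -> side; [right|left]; move: side; rewrite /heights_near;
    apply: filterS => -[x y] /= h t /h; lra.
have de : 0 < Num.min d e / 2 by rewrite divr_gt0 // lt_min d0.
have [f f0 fP] := opq0 _ de.
pose k := Num.min f (Num.min d e / 2) / 2.
have k0 : 0 < k by rewrite divr_gt0 // lt_min f0.
have kf : k < f.
  have : Num.min f (Num.min d e / 2) <= f by rewrite ge_min lexx.
  by rewrite /k => ?; lra.
have kd : k < Num.min d e / 2.
  have : Num.min f (Num.min d e / 2) <= Num.min d e / 2 by rewrite ge_min lexx orbT.
  by rewrite /k => ?; lra.
have nk : `|vec3 k 0 0| <= k.
  apply: norm_le_entry => [|i j]; first exact: ltW.
  by rewrite mxE; case: j => [[|[|[|//]]] ?] /=; rewrite ?normr0 ?(ltW k0) // gtr0_norm.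
(* A graph point displaced by [k] along x would be on this sphere, hence strictly higher than the
   maximum. *)
have [|t tk Gt] := fP (X + vec3 k 0 0).
  by rewrite -/X addrC addKr (le_lt_trans nk).
have Yn : `|X + vec3 k 0 0 + t *: e3 R - X| < Num.min d e.
  rewrite addrAC [X + _]addrC addrK (le_lt_trans (ler_normD _ _)) // normrZ.
  have := norm_e3 R; by move: (normr_ge0 t) (normr_ge0 (e3 R)) => *; nra.
move: Yn; rewrite lt_min => /andP[Yd Ye].
have := dmax _ Gt Yd; have := S1C _ (eP _ Gt Ye); rewrite dot3 /C !mxE /= => h1 h2.
have tt : k * k + t * t - 2 * (r * t) = 0 by lra.
have t0 : t <= 0 by lra.
have rt : r * t <= 0 by rewrite pmulr_rle0.
have kk : 0 < k * k by exact: mulr_gt0.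
by have := sqr_ge0 t; rewrite expr2 => ?; lra.
Qed.

End Orientation.

End Graph.

(** * The height estimate *)

(** The linear part of the reflections in the planes z = x + s. *)
Definition swap_xz (R : realType) : 'M[R]_3 := \matrix_(i, j) ((i + j == 2)%N)%:R.

Lemma swap_xz_orthogonal (R : realType) : swap_xz R *m (swap_xz R)^T = 1%:M.
Proof.
apply/matrixP => i j; rewrite !mxE !big_ord_recr big_ord0 /= !mxE /=.
by case: i => [[|[|[|//]]] ?]; case: j => [[|[|[|//]]] ?] /=;
  rewrite ?(mulr0, mul0r, mulr1, addr0, add0r).
Qed.

Lemma swap_xzE (R : realType) (x y z : R) : vec3 x y z *m swap_xz R = vec3 z y x.
Proof.
apply: rV3P; rewrite vec3E mxE !big_ord_recr big_ord0 /= !mxE /=;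
  by rewrite ?(mulr0, mulr1, addr0, add0r).
Qed.

Definition flip_z (R : realType) : 'M[R]_3 :=
  \matrix_(i, j) (if i == j then if i == 2 :> nat then -1 else 1 else 0).

Lemma flip_z_orthogonal (R : realType) : flip_z R *m (flip_z R)^T = 1%:M.
Proof.
apply/matrixP => i j; rewrite !mxE !big_ord_recr big_ord0 /= !mxE /=.
by case: i => [[|[|[|//]]] ?]; case: j => [[|[|[|//]]] ?] /=;
  rewrite ?(mulr0, mul0r, mulr1, mulrNN, addr0, add0r).
Qed.

Lemma flip_zE (R : realType) (X : 'rV[R]_3) :
  X *m flip_z R = vec3 (X 0 0) (X 0 1) (- X 0 ord_max).
Proof.
rewrite [X in LHS]vec3_eta; apply: rV3P; rewrite vec3E mxE !big_ord_recr big_ord0 /= !mxE /=;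
  by rewrite ?(mulr0, mulr1, mulrN1, addr0, add0r).
Qed.

(** * The surface satisfies the properties of the abstract graph *)

Section Height.
Variables (R : realType) (A : surface R -> Prop) (r : R) (S : surface R).
Local Notation G := (range (@immersion R S)).
Hypothesis A_hopf : hopf_family A.
Hypothesis A_radius : sphere_radius A r.
Hypothesis A_S : A S.
Hypothesis S_embedded : embedded S.
Hypothesis S_compact : compact_surface S.
Hypothesis G_graph : forall Y t, G Y -> G (Y + t *: e3 R) -> t = 0.
Hypothesis S_interior : forall p : carrier S, 0 < (@immersion R S p) 0 ord_max ->
  interior_point (@immersion R S) p.

Let A_maximum S1 : A S1 -> maximum_principle S1 S.
Proof. by case: A_hopf => _ _ _ mp A1; exact: mp. Qed.

Lemma affine_surface_continuous (M : 'M[R]_3) (b : 'rV[R]_3) (MM : M *m M^T = 1%:M)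
    (S0 : surface R) : embedded S0 -> continuous (@immersion R (affine_surface b MM S0)).
Proof.
move=> emb p; apply: (@continuous_comp _ _ _ (@immersion R S0) (affine M b)).
  exact: embedded_continuous.
exact: affine_continuous.
Qed.

(** All the spheres are translates of a single one in the family, so the sign [s] does not depend on
    the centre. *)
Lemma sphere_at : exists2 s : R, s = 1 \/ s = -1 &
  forall C X : 'rV[R]_3, dot (X - C) (X - C) = r ^+ 2 ->
  exists (S1 : surface R) (p : carrier S1),
    [/\ maximum_principle S1 S /\ continuous (@immersion R S1),
        interior_point (@immersion R S1) p, immersion p = X,
        normal p = s *: (r^-1 *: (C - X)) &
        forall Y, range (@immersion R S1) Y -> dot (Y - C) (Y - C) = r ^+ 2].
Proof.
have [r0 [S0 [c [A0 emb0 _ wb0 range0]]]] := A_radius.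
have [s s1 normal0] := sphere_normal r0 emb0 wb0 range0.
exists s => // C X XC.
have one : (1%:M : 'M[R]_3) *m 1%:M^T = 1%:M by rewrite trmx1 mulmx1.
have [p _ pX] : range (@immersion R S0) (X - (C - c)).
  have -> : X - (C - c) = X - C + c by rewrite opprB addrA addrAC.
  by rewrite range0 /esphere /= /enorm addrK XC sqrtr_sqr gtr0_norm.
pose S1 := affine_surface (C - c) one S0; exists S1, p.
have iX : immersion (p : carrier S1) = X by rewrite /= /affine mulmx1 pX subrK.
split=> //.
- split; last exact: affine_surface_continuous.
  by apply: A_maximum; apply: affine_surface_family.
- have [F HF] := sphere_interior wb0 p; exists (affine 1%:M (C - c) \o F).
  exact: local_param_affine.
- by rewrite /= mulmx1 normal0 pX opprB addrA [c + _]addrC subrK.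
- move=> _ [y _ <-]; rewrite -(sphere_dot range0 y) /= /affine mulmx1.
  by rewrite addrA addrAC addrK.
Qed.

(** By compactness of S it suffices to treat the points near one [p]: either a horizontal coordinate
    of [p] differs from that of [Z], or [p] is strictly lower than [Z], and both conditions are
    stable. *)
Lemma hypograph_closed Z : ~ hypograph G Z -> exists2 d, 0 < d &
  forall Y, `|Y - Z| < d -> ~ hypograph G Y.
Proof.
move=> nZ; have /compact_near_coveringP cov := S_compact.
have cont := embedded_continuous S_embedded.
pose P (Y : 'rV[R]_3) (p : carrier S) := ~ exists2 t, 0 <= t & immersion p = Y + t *: e3 R.
suff : \forall Y \near Z, [set: carrier S] `<=` P Y.
  move=> /nbhs_normP[d /= d0 dP]; exists d => // Y YZ [t t0 [p _ pY]].
  by apply: (dP Y _ p I); [rewrite /ball_ /= distrC|exists t].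
apply: (cov _ (nbhs Z) P) => p _.
have separated (d : R) : 0 < d ->
    (forall X Y, `|X - immersion p| < d -> `|Y - Z| < d ->
       ~ exists2 t, 0 <= t & X = Y + t *: e3 R) ->
    \forall x \near p & Y \near Z, P Y x.
  move=> d0 H; exists ([set x | `|@immersion R S x - immersion p| < d], [set Y | `|Y - Z| < d]).
    split => /=; first exact: near_norm_lt.
    rewrite -[nbhs Z _]/(\forall Y \near Z, `|Y - Z| < d).
    by apply/nbhs_normP; exists d => // Y; rewrite /ball_ /= distrC.
  by move=> [x Y] [/= hx hY]; exact: H.
have differ i : immersion p 0 i != Z 0 i -> i != ord_max ->
    \forall x \near p & Y \near Z, P Y x.
  move=> ne imax; apply: (separated (`|immersion p 0 i - Z 0 i| / 2)).
    by rewrite divr_gt0 // normr_gt0 subr_eq0.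
  move=> X Y /(close_entry i) hX /(close_entry i) hY [t _ XY].
  have XYi : X 0 i = Y 0 i.
    rewrite XY !mxE; case: i imax {ne hX hY} => [[|[|[|//]]] hi] //= _; by rewrite mulr0 addr0.
  move: hX hY; rewrite /close XYi {XY}.
  by case: (ger0P (immersion p 0 i - Z 0 i)) => ? *; lra.
have [e0|ne0] := eqVneq (immersion p 0 0) (Z 0 0); last exact: (differ 0).
have [e1|ne1] := eqVneq (immersion p 0 1) (Z 0 1); last exact: (differ 1).
have pZ : immersion p 0 ord_max < Z 0 ord_max.
  rewrite ltNge; apply/negP => Zp; apply: nZ; exists (immersion p 0 ord_max - Z 0 ord_max).
    by rewrite subr_ge0.
  exists p => //; apply: rV3P; rewrite !mxE /= ?mulr0 ?addr0 //.
  by rewrite mulr1 addrC subrK.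
apply: (separated ((Z 0 ord_max - immersion p 0 ord_max) / 2)).
  by rewrite divr_gt0 // subr_gt0.
move=> X Y /(close_entry ord_max) hX /(close_entry ord_max) hY [t t0 XY].
have : X 0 ord_max = Y 0 ord_max + t by rewrite XY !mxE /= mulr1.
by move: hX hY {XY}; rewrite /close => *; lra.
Qed.

Let Gc x y z := G (vec3 x y z).

Lemma hypograph_vec3 x y z : hypograph G (vec3 x y z) <-> under Gc x y z.
Proof. by split=> -[t t0 Gt]; exists t => //; move: Gt; rewrite /Gc addZ_e3. Qed.

Lemma norm_vec3_lt (x y z x' y' z' d : R) : 0 < d ->
  close d x x' -> close d y y' -> close d z z' -> `|vec3 x' y' z' - vec3 x y z| < d.
Proof. by move=> d0 *; apply: norm_lt3; rewrite ?vec3E. Qed.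

Lemma dot_vec3 (x y z x' y' z' : R) :
  dot (vec3 x y z - vec3 x' y' z') (vec3 x y z - vec3 x' y' z') =
  (x - x') ^+ 2 + (y - y') ^+ 2 + (z - z') ^+ 2.
Proof. by rewrite dot3 !mxE /= !expr2. Qed.

Lemma maximum_height x y z : Gc x y z -> z <= 4 * r.
Proof.
have r0 : 0 < r by case: A_radius.
have [s s1 sphere] := sphere_at.
have ss : s * s = 1 by case: s1 => ->; lra.
have inw q : 0 < @immersion R S q 0 ord_max ->
    inward G (immersion q) (s *: normal q) /\ normal q = s *: (s *: @normal R S q).
  move=> hq; split; last by rewrite scalerA ss scale1r.
  apply: (orientation S_embedded S_compact G_graph S_interior r0 s1) hq => C X XC.
  by have [S1 [p [[mp _] ip pX pN pC]]] := sphere C X XC; exists S1, p.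
have interior x1 y1 z1 : Gc x1 y1 z1 -> 0 < z1 -> exists q : carrier S,
    immersion q = vec3 x1 y1 z1 /\ 0 < @immersion R S q 0 ord_max.
  by move=> [q _ qX] z0; exists q; rewrite qX vec3E.
apply: (graph_height r0).
- have : compact G.
    have := continuous_compact _ S_compact; apply.
    exact/continuous_subspaceT/embedded_continuous.
  move=> /compact_bounded[M [_ MP]]; exists (M + 2) => x1 y1 z1 GX.
  have MX : `|vec3 x1 y1 z1 - 0| < M + 2.
    by rewrite subr0 (@le_lt_trans _ _ (M + 1)) ?MP //; lra.
  by split; [have := close_entry 0 MX|have := close_entry 1 MX|have := close_entry ord_max MX]; rewrite vec3E mxE.
- move=> a x1 y1 z1 nu; have [|d d0 dP] := @hypograph_closed (vec3 x1 y1 z1).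
    by move/hypograph_vec3.
  exists d => // a' x' y' z' _ hx hy hz /hypograph_vec3; apply: dP.
  exact: norm_vec3_lt.
- move=> x1 y1 z1 z2 G1 G2; apply/eqP; rewrite -subr_eq0; apply/eqP.
  by apply: (G_graph G2); rewrite addZ_e3 addrC subrK.
- move=> x1 y1 z1 e G1 z10 e0; have [q [qX hq]] := interior _ _ _ G1 z10.
  have [d d0 dP] := graph_open S_embedded G_graph (S_interior hq) e0.
  exists d => // x' y' hx hy; have [|t te Gt] := dP (vec3 x' y' z1).
    by rewrite qX; apply: norm_vec3_lt => //; rewrite /close; lra.
  exists (z1 + t); last by move: Gt; rewrite addZ_e3.
  by move: te; rewrite ltr_norml /close; lra.
- move=> a b c x1 y1 z1 G1 z10 on_sphere [d d0 dP].
  have [q [qX hq]] := interior _ _ _ G1 z10.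
  pose C := vec3 a b c; pose X := vec3 x1 y1 z1.
  have XC : dot (X - C) (X - C) = r ^+ 2 by rewrite dot_vec3.
  have [S1 [p [[mp c1] ip pX pN pC]]] := sphere C X XC.
  have [inq Nq] := inw q hq.
  have ball Y : `|Y - X| < d -> dot (Y - C) (Y - C) <= r ^+ 2 -> hypograph G Y.
    rewrite [Y]vec3_eta dot_vec3 => YX YC; apply/hypograph_vec3; apply: dP => //.
    + by have := close_entry 0 YX; rewrite !vec3E.
    + by have := close_entry 1 YX; rewrite !vec3E.
    + by have := close_entry ord_max YX; rewrite !vec3E.
  have [|||e e0 eP] := inside_contact S_embedded G_graph mp c1 ip (S_interior hq) _ s1 pN Nq inq.
  + by rewrite pX qX.
  + have : \forall y \near p, `|@immersion R S1 y - immersion p| < d by exact: near_norm_lt.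
    apply: filterS => u; rewrite pX => uX; apply: ball => //.
    by rewrite pC //; exists u.
  + move=> v vm; pose w := dot v (r^-1 *: (C - X)).
    have v1 : 0 < `|v| + 1 by rewrite ltr_wpDl.
    have dv : 0 < dot v v + 1 by rewrite ltr_wpDl // dot_ge0.
    (* The ray from [X] along [v] stays in the ball as long as [t * dot v v <= 2 * r * w]. *)
    exists (Num.min (d / (`|v| + 1)) (2 * r * w / (dot v v + 1))).
      have w0 : 0 < w := vm.
      have rw0 : 0 < 2 * r * w by rewrite !mulr_gt0.
      by rewrite lt_min; apply/andP; split; exact: divr_gt0.
    move=> t; rewrite lt_min !ltr_pdivlMr // => /andP[t0 /andP[td tw]].
    rewrite qX; apply: ball.
      rewrite -/X addrC addKr normrZ gtr0_norm //.
      by move: (normr_ge0 v) => *; nra.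
    have wE : dot v (X - C) = - (r * w).
      by rewrite /w dotZr mulrA mulfV ?gt_eqF // mul1r -dotNr opprB.
    rewrite -/X addrAC; move: (X - C) XC wE => V VV vV.
    rewrite dotDl !dotDr VV !dotZl !dotZr (dotC V) vV.
    by have := dot_ge0 v; move: (dot v v) tw t0 r0 {dv} => vv tw t0 r0 vv0; nra.
  exists e => // x' y' z' hx hy hz G'.
  rewrite -dot_vec3; apply: pC; apply: eP => //.
  by rewrite qX; exact: norm_vec3_lt.
- move=> a k x1 y1 z1 G1 z10 G2 xk [d d0 dP].
  have [q [qX hq]] := interior _ _ _ G1 z10.
  have [q' [q'X hq']] := interior _ _ _ G2 xk.
  have MM := swap_xz_orthogonal R.
  (* The glide reflection of [G_reflection], with [a] as its first parameter because [s] is already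
     the orientation sign. *)
  pose b : 'rV[R]_3 := vec3 (- a) 0 k.
  have phiE x2 y2 z2 : affine (swap_xz R) b (vec3 x2 y2 z2) = vec3 (z2 - a) y2 (x2 + k).
    by rewrite /affine swap_xzE; apply: rV3P; rewrite !mxE /= ?addr0.
  pose S1 := affine_surface b MM S; pose p : carrier S1 := q.
  have mp : maximum_principle S1 S by apply: A_maximum; apply: affine_surface_family.
  have c1 : continuous (@immersion R S1) by exact: affine_surface_continuous.
  have ip : interior_point (@immersion R S1) p.
    have [F HF] := S_interior hq; exists (affine (swap_xz R) b \o F).
    exact: local_param_affine.
  have pq : immersion p = immersion q' by rewrite /= qX phiE q'X.
  have [inq Nq] := inw q hq; have [inq' Nq'] := inw q' hq'.
  have phi_hyp Y : `|Y - immersion q| < d -> hypograph G Y ->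
      hypograph G (affine (swap_xz R) b Y).
    rewrite qX [Y]vec3_eta phiE => YX /hypograph_vec3 uY; apply/hypograph_vec3.
    apply: dP uY.
    + by have := close_entry 0 YX; rewrite !vec3E.
    + by have := close_entry 1 YX; rewrite !vec3E.
    + by have := close_entry ord_max YX; rewrite !vec3E.
  (* The image surface carries the normal field of [S] along, so the same sign [s] gives its inward
     normal. *)
  pose m := s *: (normal q *m swap_xz R).
  have pm : normal p = s *: m by rewrite /m scalerA ss scale1r.
  have [||e e0 eP] := inside_contact S_embedded G_graph mp c1 ip (S_interior hq') pq s1 pm Nq' inq'.
  + have : \forall u \near p, `|@immersion R S u - immersion q| < d.
      by apply: (@near_norm_lt _ _ (@immersion R S) q) => //; exact: embedded_continuous.
    by apply: filterS => u uX; apply: phi_hyp => //; apply: graph_hypograph; exists u.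
  (* A direction positive on [m] pulls back to one that leads under the graph at [q], and [phi_hyp]
     maps the points so reached to points under the graph. *)
  + move=> v vm; have [_ cone _] := inq.
    have [|e e0 eP] := cone (v *m (swap_xz R)^T).
      move: vm; rewrite /m !dotZr => vm.
      by rewrite dotC -dot_orthogonalC // dotC.
    have v1 : 0 < `|v *m (swap_xz R)^T| + 1 by rewrite ltr_wpDl.
    exists (Num.min e (d / (`|v *m (swap_xz R)^T| + 1))) => [|t].
      by rewrite lt_min e0 divr_gt0.
    rewrite lt_min ltr_pdivlMr // => /andP[t0 /andP[te td]].
    have -> : immersion q' + t *: v =
        affine (swap_xz R) b (immersion q + t *: (v *m (swap_xz R)^T)).
      rewrite -pq /= /affine mulmxDl -scalemxAl -mulmxA (mulmx1C MM) mulmx1.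
      by rewrite addrAC.
    apply: phi_hyp.
      rewrite addrC addKr normrZ gtr0_norm //.
      by move: (normr_ge0 (v *m (swap_xz R)^T)) => *; nra.
    by apply/strict_hypograph_hypo/eP; rewrite t0.
  exists e => // x' y' z' hx hy hz G'.
  have [|u _] := eP _ G'; first by rewrite q'X; exact: norm_vec3_lt.
  rewrite /= [@immersion R S u]vec3_eta phiE => uE.
  have [e1 e2 e3'] : [/\ @immersion R S u 0 ord_max - a = x', @immersion R S u 0 1 = y' &
      @immersion R S u 0 0 + k = z'].
    by move: uE => /rowP uE; have := uE 0; have := uE 1; have := uE ord_max; rewrite !vec3E.
  exists u => //; rewrite [LHS]vec3_eta -e1 -e2 -e3'; congr vec3; ring.
Qed.

End Height.

(** * Reflection in the plane z = 0 *)

Section Flip.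
Variables (R : realType) (S : surface R).
Local Notation S' := (affine_surface 0 (flip_z_orthogonal R) S).

Lemma flip_immersion (p : carrier S) : (immersion (p : carrier S')) =
  vec3 (immersion p 0 0) (immersion p 0 1) (- immersion p 0 ord_max).
Proof. by rewrite /= /affine flip_zE addr0. Qed.

Lemma flip_embedded : embedded S -> embedded S'.
Proof.
move=> emb; have [g [[ci cg] _ _ gi ig]] := emb.
have flipK (X : 'rV[R]_3) : affine (flip_z R) 0 (affine (flip_z R) 0 X) = X.
  by rewrite /affine !addr0 !flip_zE !vec3E opprK -vec3_eta.
exists (g \o affine (flip_z R) 0); split=> //.
- split.
    by apply: continuous_subspaceT; exact: affine_surface_continuous.
  apply/subspace_continuousP => Y [p _ pY] V /= VgY.
  have cgp : g @ within (range (@immersion R S)) (nbhs (@immersion R S p)) --> g (@immersion R S p).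
    by move/subspace_continuousP : cg; apply; exists p.
  have gY : g (affine (flip_z R) 0 Y) = g (@immersion R S p) by rewrite -pY /= flipK.
  have {}VgY : nbhs (g (affine (flip_z R) 0 Y)) V := VgY.
  rewrite gY in VgY.
  have near_p : \forall Z \near @immersion R S p, range (@immersion R S) Z -> V (g Z) := cgp V VgY.
  have : \forall Z \near Y, range (@immersion R S) (affine (flip_z R) 0 Z) ->
      V (g (affine (flip_z R) 0 Z)).
    have fY : affine (flip_z R) 0 Y = @immersion R S p by rewrite -pY /= flipK.
    have cY : affine (flip_z R) 0 @ Y --> @immersion R S p.
      by rewrite -fY; exact: affine_continuous.
    exact: (cY _ near_p).
  move=> near_Y; suff : \forall Z \near Y, range (@immersion R S') Z ->
      V (g (affine (flip_z R) 0 Z)) by [].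
  apply: filterS near_Y => Z nV [u _ uZ]; apply: nV.
  by exists u => //; rewrite -uZ /= flipK.
- by move=> p _ /=; rewrite flipK gi.
- by move=> Y [p _ <-] /=; rewrite flipK ig //; exists p.
Qed.

End Flip.

Unset Implicit Arguments.

Theorem theorem4 (R : realType) (A : surface R -> Prop) (RA : R)
  (S : surface R) (Omega : set 'rV[R]_2) (u : 'rV[R]_2 -> R) :
  hopf_family A ->
  sphere_radius A RA ->
  A S ->
  compact_surface S ->
  closed_domain Omega ->
  graph_on S Omega u ->
  (forall p : carrier S, boundary_point (@immersion R S) p ->
     xy_plane (immersion p)) ->
  forall p : carrier S, dist_to (@xy_plane R) (immersion p) <= 4 * RA.
Proof.
move=> hA rA AS cS _ [eS gS] bS p.
have graph Y t : range (@immersion R S) Y -> range (@immersion R S) (Y + t *: e3 R) -> t = 0.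
  rewrite gS => -[w _ <-] [w' _]; rewrite addZ_e3 => /rowP ww.
  have := ww 0; have := ww 1; have := ww ord_max; rewrite !vec3E => h2 h1 h0.
  have E : w = w'.
    apply/rowP => -[[|[|//]] hi].
    + by rewrite (_ : Ordinal hi = 0) //; apply: val_inj.
    + by rewrite (_ : Ordinal hi = 1) //; apply: val_inj.
  by move: h2; rewrite E => /eqP; rewrite -subr_eq0 opprD addrA subrr add0r oppr_eq0 => /eqP.
have int (q : carrier S) : @immersion R S q 0 ord_max != 0 -> interior_point (@immersion R S) q.
  by move=> qz; have [//|/bS/eqP] := surface_locally q; rewrite (negbTE qz).
have high : immersion p 0 ord_max <= 4 * RA.
  apply: (maximum_height hA rA AS eS cS graph _ (x := immersion p 0 0) (y := immersion p 0 1)).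
    by move=> q qz; apply: int; rewrite gt_eqF.
  by rewrite -vec3_eta; exists p.
have low : - immersion p 0 ord_max <= 4 * RA.
  pose S' := affine_surface 0 (flip_z_orthogonal R) S.
  have AS' : A S' by apply: affine_surface_family.
  apply: (maximum_height hA rA AS' (flip_embedded eS) cS _ _ (x := immersion p 0 0) (y := immersion p 0 1)).
  - move=> Y t [q _ <-] [q' _]; rewrite !flip_immersion addZ_e3 => /rowP ww.
    have := ww 0; have := ww 1; have := ww ord_max; rewrite !vec3E => h2 h1 h0.
    suff : - t = 0 by move/eqP; rewrite oppr_eq0 => /eqP.
    apply: (graph (@immersion R S q)); first by exists q.
    exists q' => //; rewrite [LHS]vec3_eta [@immersion R S q]vec3_eta addZ_e3 h0 h1.
    by congr vec3; rewrite -[LHS]opprK h2 opprD opprK.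
  - move=> q; rewrite flip_immersion vec3E oppr_gt0 => qz.
    have [F HF] := int q (ltr0_neq0 qz); exists (affine (flip_z R) 0 \o F).
    exact: (local_param_affine 0 (flip_z_orthogonal R) HF).
  - by exists p => //; rewrite flip_immersion.
apply: (@le_trans _ _ `|immersion p 0 ord_max|); last by rewrite ler_norml; lra.
(* The foot of the perpendicular to the plane bounds the infimum. *)
apply: ge_inf; first by exists 0 => _ [y _ <-]; exact: enorm_ge0.
exists (vec3 (immersion p 0 0) (immersion p 0 1) 0); first by rewrite /xy_plane /= vec3E.
rewrite /enorm dot3 !mxE /= !subrr mul0r !add0r subr0 -expr2 sqrtr_sqr //.
Qed.
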